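(* Let $\mathcal{P}=\mathrm{Inv}\langle A\mid R\rangle$ be a finite presentation of an inverse monoid with $A=\{a_1,\ldots,a_m\}$. If $M_i=\widetilde{A_i}^*/(\rho_{A_i}\cup R\overline{\theta}_i)^\sharp$ is finite-$\mathcal{J}$-above for $i=1,\ldots,m$, then the membership problem is decidable for $\mathrm{Im}\,\epsilon^{\mathcal{P}}\le\prod_{i=1}^m M_i$. In particular, this holds if $\mathcal{P}$ is the canonical presentation $\mathrm{Inv}\langle A\mid\emptyset\rangle$ of a free inverse monoid.
   Context: For a set $B$ put $\widetilde{B}=B\cup B^{-1}$, with $B^{-1}$ a set of formal inverses, and extend $^{-1}$ to an involution of the free monoid $\widetilde{B}^*$ by $1^{-1}=1$, $(uv)^{-1}=v^{-1}u^{-1}$. Let $\rho_B$ be the congruence on $\widetilde{B}^*$ generated by all pairs $(ww^{-1}w,w)$ and $(uu^{-1}vv^{-1},vv^{-1}uu^{-1})$ with $u,v,w\in\widetilde{B}^*$. The inverse monoid defined by $\mathrm{Inv}\langle B\mid S\rangle$, $S\subseteq\widetilde{B}^*\times\widetilde{B}^*$, is $\widetilde{B}^*/(\rho_B\cup S)^\sharp$, where $^\sharp$ denotes the generated congruence; the presentation is finite if $B,S$ are finite. Eraser morphism: given $\mathcal{P}=\mathrm{Inv}\langle A\mid R\rangle$ with $A=\{a_1,\ldots,a_m\}$, let $A_i=A\setminus\{a_i\}$ and let $\theta_i:\widetilde{A}^*\to\widetilde{A_i}^*$ be the homomorphism deleting the letters $a_i,a_i^{-1}$ and fixing the others. Put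 $R\overline{\theta}_i=\{(u\theta_i,v\theta_i)\mid (u,v)\in R\}$, $M=\widetilde{A}^*/(\rho_A\cup R)^\sharp$ and $M_i=\widetilde{A_i}^*/(\rho_{A_i}\cup R\overline{\theta}_i)^\sharp$. The map $\epsilon_i^{\mathcal{P}}:M\to M_i$ sending the class of $w$ to the class of $w\theta_i$ is a well-defined surjective homomorphism, and $\epsilon^{\mathcal{P}}:M\to\prod_{i=1}^m M_i$ is $x\mapsto (x\epsilon_1^{\mathcal{P}},\ldots,x\epsilon_m^{\mathcal{P}})$. An element $u$ of a monoid $N$ is a factor of $v\in N$ if $v=xuy$ for some $x,y\in N$; $N$ is finite-$\mathcal{J}$-above if every element of $N$ has only finitely many factors. The membership problem for a subset $L$ of a finitely generated monoid $N$ asks for an algorithm that, given an element $g\in N$ (by words in the generators), decides whether $g\in L$. *)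

(* Defs.v *)
From HB Require Import structures.
From mathcomp Require Import all_boot all_classical.

Set Implicit Arguments.
Unset Strict Implicit.
Unset Printing Implicit Defensive.

Local Open Scope classical_set_scope.
Local Open Scope quotient_scope.

(* Words over B and its formal inverses: (b, false) stands for the letter b,
   (b, true) for its formal inverse. *)
Definition word (B : Type) := seq (B * bool).

Definition letter_inv (B : Type) (l : B * bool) : B * bool := (l.1, ~~ l.2).
Definition word_inv (B : Type) (w : word B) : word B :=
  rev [seq letter_inv l | l <- w].

Inductive congr_gen (B : Type) (E : set (word B * word B)) :
    word B -> word B -> Prop :=
| congr_base u v : E (u, v) -> congr_gen E u v
| congr_refl u : congr_gen E u u
| congr_sym u v : congr_gen E u v -> congr_gen E v u
| congr_trans u v w : congr_gen E u v -> congr_gen E v w -> congr_gen E u w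
| congr_ctx x y u v :
    congr_gen E u v -> congr_gen E (x ++ u ++ y) (x ++ v ++ y).

(* The Wagner congruence, whose quotient is the free inverse monoid on B. *)
Definition wagner_pairs (B : Type) : set (word B * word B) :=
  [set p | (exists w, p = (w ++ word_inv w ++ w, w)) \/
           (exists u v, p = (u ++ word_inv u ++ v ++ word_inv v,
                             v ++ word_inv v ++ u ++ word_inv u))].
Definition wagner (B : Type) : set (word B * word B) :=
  [set p | congr_gen (@wagner_pairs B) p.1 p.2].

Section InversePresentation.
Variables (B : choiceType) (S : set (word B * word B)).

Definition pres_congr (u v : word B) : Prop :=
  congr_gen (@wagner B `|` S) u v.
Definition pres_rel : rel (word B) := fun u v => `[< pres_congr u v >].

Lemma pres_rel_refl : reflexive pres_rel.
Proof. by move=> u; apply/asboolP; exact: congr_refl. Qed.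
Lemma pres_rel_sym : symmetric pres_rel.
Proof. by move=> u v; apply/asboolP/asboolP; exact: congr_sym. Qed.
Lemma pres_rel_trans : transitive pres_rel.
Proof.
by move=> v u w /asboolP uv /asboolP vw; apply/asboolP; exact: congr_trans vw.
Qed.

Canonical pres_equiv :=
  EquivRel pres_rel pres_rel_refl pres_rel_sym pres_rel_trans.

Definition inv_monoid := {eq_quot pres_equiv}.
HB.instance Definition _ := Choice.on inv_monoid.
HB.instance Definition _ := EqQuotient.on inv_monoid.

Lemma inv_monoid_eqP (u v : word B) :
  u = v %[mod inv_monoid] <-> pres_congr u v.
Proof. by split=> [/eqmodP/asboolP|?]; last by apply/eqmodP/asboolP. Qed.

Lemma pres_congr_cat (u u' v v' : word B) :
  pres_congr u u' -> pres_congr v v' -> pres_congr (u ++ v) (u' ++ v').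
Proof.
move=> uu' vv'; apply: congr_trans (_ : pres_congr (u' ++ v) _).
  exact: (congr_ctx [::] v uu').
by have := congr_ctx u' [::] vv'; rewrite !cats0.
Qed.

Definition inv_one : inv_monoid := \pi_inv_monoid [::].
Definition inv_mul (x y : inv_monoid) : inv_monoid :=
  \pi_inv_monoid (repr x ++ repr y).

Lemma inv_mul_pi (u v : word B) :
  inv_mul (\pi u) (\pi v) = \pi_inv_monoid (u ++ v).
Proof.
by apply/inv_monoid_eqP/pres_congr_cat; apply/inv_monoid_eqP; rewrite reprK.
Qed.

Lemma inv_mulA : associative inv_mul.
Proof.
by move=> x y z; rewrite -[x]reprK -[y]reprK -[z]reprK !inv_mul_pi catA.
Qed.
Lemma inv_mul1 : left_id inv_one inv_mul.
Proof. by move=> x; rewrite -[x]reprK inv_mul_pi. Qed.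
Lemma inv_mulr1 : right_id inv_one inv_mul.
Proof. by move=> x; rewrite -[x]reprK inv_mul_pi cats0. Qed.

HB.instance Definition _ :=
  isMonoid.Build inv_monoid inv_mulA inv_mul1 inv_mulr1.

End InversePresentation.

Section ProductMonoid.
Variables (I : Type) (M : I -> monoidType).

Definition prod_monoid := forall i, M i.
HB.instance Definition _ := gen_eqMixin prod_monoid.
HB.instance Definition _ := gen_choiceMixin prod_monoid.

Let pmul (f g : prod_monoid) : prod_monoid := fun i => (f i * g i)%g.
Let pone : prod_monoid := fun=> 1%g.

Let pmulA : associative pmul.
Proof.
by move=> f g h; apply: functional_extensionality_dep => i; exact: mulgA.
Qed.
Let pmul1 : left_id pone pmul.
Proof.
by move=> f; apply: functional_extensionality_dep => i; exact: mul1g.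
Qed.
Let pmulr1 : right_id pone pmul.
Proof.
by move=> f; apply: functional_extensionality_dep => i; exact: mulg1.
Qed.

HB.instance Definition _ := isMonoid.Build prod_monoid pmulA pmul1 pmulr1.

End ProductMonoid.

Section Eraser.
Variables (A : finType) (R : set (word A * word A)).

Definition erase (i : A) (w : word A) : word {x : A | x != i} :=
  pmap (fun l => omap (fun x => (x, l.2)) (insub l.1)) w.

Definition erase_rels (i : A) :
    set (word {x : A | x != i} * word {x : A | x != i}) :=
  [set (erase i p.1, erase i p.2) | p in R].
Arguments erase_rels : clear implicits.

Definition erased_monoid (i : A) := inv_monoid (erase_rels i).
HB.instance Definition _ (i : A) := Monoid.on (erased_monoid i).
HB.instance Definition _ (i : A) := EqQuotient.on (erased_monoid i).

Definition eraser (i : A) (x : inv_monoid R) : erased_monoid i :=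
  \pi_(erased_monoid i) (erase i (repr x)).

Lemma erase_cat i u v : erase i (u ++ v) = erase i u ++ erase i v.
Proof. by rewrite /erase pmap_cat. Qed.

Lemma erase_word_inv i w : erase i (word_inv w) = word_inv (erase i w).
Proof.
elim: w => // -[a b] w IHw.
rewrite /word_inv /= rev_cons -cats1 erase_cat [in LHS]IHw.
rewrite /erase /=; case: insubP => [x _ xa|_] /=; last by rewrite cats0.
by rewrite rev_cons cats1.
Qed.

Lemma erase_wagner i u v :
  wagner (u, v) -> wagner (erase i u, erase i v).
Proof.
rewrite /wagner /=; elim=> {u v} [u v|u|u v _ ?|u v w _ ? _ ?|x y u v _ ?].
- move=> [[w [-> ->]]|[w [z [-> ->]]]]; apply: congr_base;
    rewrite !erase_cat !erase_word_inv; first by left; exists (erase i w).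
  by right; exists (erase i w), (erase i z).
- exact: congr_refl.
- exact: congr_sym.
- by apply: congr_trans; eassumption.
- by rewrite !erase_cat; exact: congr_ctx.
Qed.

Lemma erase_congr i u v :
  pres_congr R u v -> pres_congr (erase_rels i) (erase i u) (erase i v).
Proof.
rewrite /pres_congr; elim=> {u v} [u v|u|u v _ ?|u v w _ ? _ ?|x y u v _ ?].
- case=> [/(erase_wagner i) uv|Ruv]; apply: congr_base; first by left.
  by right; exists (u, v).
- exact: congr_refl.
- exact: congr_sym.
- by apply: congr_trans; eassumption.
- by rewrite !erase_cat; exact: congr_ctx.
Qed.

(* The eraser morphism does not depend on the chosen representative. *)
Lemma eraser_pi i (w : word A) :
  eraser i (\pi w) = \pi_(erased_monoid i) (erase i w).
Proof.
by apply/inv_monoid_eqP/erase_congr/inv_monoid_eqP; rewrite reprK.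
Qed.

Definition eps (x : inv_monoid R) : prod_monoid erased_monoid :=
  fun i => eraser i x.

Lemma eps_morphism : monoid_morphism eps.
Proof.
split=> [|x y]; apply: functional_extensionality_dep => i; rewrite /eps.
  exact: eraser_pi.
rewrite -[x]reprK -[y]reprK.
rewrite -[(_ * _)%g]/(inv_mul _ _) inv_mul_pi eraser_pi erase_cat.
rewrite -[RHS]/(inv_mul (eraser i _) (eraser i _)).
by rewrite !eraser_pi inv_mul_pi.
Qed.
HB.instance Definition _ :=
  isUMagmaMorphism.Build (inv_monoid R) (prod_monoid erased_monoid) eps
    eps_morphism.

End Eraser.

Section Factors.
Variable N : monoidType.

Definition is_factor (u v : N) : Prop := exists x y : N, v = (x * u * y)%g.

Definition finite_J_above : Prop :=
  forall v : N, finite_set [set u | is_factor u v].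

End Factors.

(* The total recursive functions, in the characterization that restricts
   minimization to functions having a zero for every parameter, so that no
   partial function occurs. *)
Inductive recursive : forall n, (n.-tuple nat -> nat) -> Prop :=
| rec_zero n : recursive (fun _ : n.-tuple nat => 0)
| rec_succ : recursive (fun x : 1.-tuple nat => (thead x).+1)
| rec_proj n (i : 'I_n) : recursive (fun x : n.-tuple nat => tnth x i)
| rec_comp k n (f : k.-tuple nat -> nat) (g : 'I_k -> n.-tuple nat -> nat) :
    recursive f -> (forall j, recursive (g j)) ->
    recursive (fun x => f [tuple g j x | j < k])
| rec_prim n (f : n.-tuple nat -> nat) (g : n.+2.-tuple nat -> nat)
    (h : n.+1.-tuple nat -> nat) :
    recursive f -> recursive g ->
    (forall x : n.-tuple nat, h [tuple of 0 :: x] = f x) ->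
    (forall y (x : n.-tuple nat),
       h [tuple of y.+1 :: x] = g [tuple of y :: h [tuple of y :: x] :: x]) ->
    recursive h
| rec_mu n (f : n.+1.-tuple nat -> nat) (h : n.-tuple nat -> nat) :
    recursive f ->
    (forall x : n.-tuple nat, f [tuple of h x :: x] = 0) ->
    (forall (x : n.-tuple nat) y, y < h x -> f [tuple of y :: x] <> 0) ->
    recursive h.

Definition recursive_set (D : set nat) : Prop :=
  recursive (fun x : 1.-tuple nat => nat_of_bool `[< D (thead x) >]).

Section Membership.
Variable N : monoidType.

Definition eval_word k (g : 'I_k -> N) (w : seq 'I_k) : N :=
  (\prod_(j <- w) g j)%g.

Definition generates k (g : 'I_k -> N) : Prop :=
  forall x : N, exists w, x = eval_word g w.

(* CodeSeq.code is an explicit recursive bijection from seq nat to nat, and the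
   codes of words over k letters form a recursive set. *)
Definition word_code k (w : seq 'I_k) : nat :=
  CodeSeq.code [seq nat_of_ord j | j <- w].

(* Decidability does not depend on the finite generating family, so it is
   required for all of them; finite generation keeps this from being vacuous. *)
Definition decidable_membership (L : set N) : Prop :=
  (exists k (g : 'I_k -> N), generates g) /\
  forall k (g : 'I_k -> N), generates g ->
    recursive_set [set word_code w | w in [set w | L (eval_word g w)]].

End Membership.

(* Main.v *)
(* By Post's theorem it suffices that membership of [g] in the image of [eps]
   and its negation are both recursively enumerable, uniformly in a word for
   [g]. A membership certificate is a word [v] together with derivations of
   [erase i v = g_i] in every [M_i]. For the negation, right multiplication
   by the letters acts by partial injections on the factors of [g_i], of
   which there are finitely many; by the Wagner-Preston argument two elements
   acting alike, one of them being [g_i], are equal. Hence a non-member is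
   certified by a finite inverse automaton satisfying the relations, together
   with a finite set of state vectors that contains the initial one, is
   closed under the letters and misses the vector of [g]. A free inverse
   monoid is finite-J-above because an element is determined by its Munn tree
   and its reduced word, and for a factor of [v] both only involve reduced
   words of length at most [2 |v|]. *)

Require Import Defs.
From mathcomp Require Import all_boot all_classical.

Set Implicit Arguments.
Unset Strict Implicit.
Unset Printing Implicit Defensive.

Local Open Scope classical_set_scope.
Local Open Scope quotient_scope.

(** * Recursive functions on codes of sequences *)

(** Finite-J-aboveness says that an element has finitely many factors, but gives neither their
    number nor their multiplication, so no automaton can be computed from $g$. Automata are
    therefore searched for: every finite table is a candidate, checking a candidate is computable,
    soundness holds for every table that passes, and finiteness serves only to show, by classical
    choice, that a non-member has a table that passes. Membership asks for one word $v$ common to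
    all components, so deciding equality in each $M_i$ separately would not suffice. Hence a single
    automaton serves all $i$: each state carries an index $i$, the letters $a_i^{\pm1}$ loop at the
    states of index $i$, and a word over $A$ runs in all components at once. The components of $g$,
    in contrast, are given by unrelated words, and each state reads the word of its own index. Since
    [recursive] speaks of tuples of numbers, searches and checks are transported to words and tables
    along [pickle]. *)

Lemma behead_tuple_cons n T (a : T) (x : n.-tuple T) :
  behead_tuple [tuple of a :: x] = x.
Proof. exact: val_inj. Qed.

Section RecursiveTuples.
Variable n : nat.
Implicit Types (f g : n.-tuple nat -> nat).

Lemma recursive_ext f g : recursive f -> f =1 g -> recursive g.
Proof. by move=> rf /funext <-. Qed.

Lemma recursive_app1 (F : nat -> nat) f :
  recursive (fun x : 1.-tuple nat => F (thead x)) -> recursive f ->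
  recursive (fun x => F (f x)).
Proof.
move=> rF rf; have := @rec_comp 1 n _ (fun=> f) rF (fun=> rf).
by move/recursive_ext; apply=> x; rewrite /thead tnth_mktuple.
Qed.

Lemma recursive_succ f : recursive f -> recursive (fun x => (f x).+1).
Proof. exact: recursive_app1 rec_succ. Qed.

Lemma recursive_const c : recursive (fun _ : n.-tuple nat => c).
Proof. by elim: c => [|c IH]; [exact: rec_zero|exact: recursive_succ]. Qed.

(** [rec_prim] recurses on the first coordinate only; composing with [x] mapped to [c x :: x] lets
    the depth of the recursion be computed from the parameters. *)
Lemma recursive_nat_rect c f (g : nat -> nat -> n.-tuple nat -> nat) :
  recursive c -> recursive f ->
  recursive (fun z : n.+2.-tuple nat =>
    g (thead z) (thead (behead_tuple z)) (behead_tuple (behead_tuple z))) ->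
  recursive (fun x => nat_rect (fun=> nat) (f x) (fun y h => g y h x) (c x)).
Proof.
move=> rc rf rg.
pose h (z : n.+1.-tuple nat) := nat_rect (fun=> nat) (f (behead_tuple z))
  (fun y h => g y h (behead_tuple z)) (thead z).
have rh : recursive h.
  by apply: rec_prim rf rg _ _ => [x|y x]; rewrite /h !theadE !behead_tuple_cons.
pose G (j : 'I_n.+1) (x : n.-tuple nat) := tnth [tuple of c x :: x] j.
have rG j : recursive (G j).
  case: (unliftP ord0 j) => [i ->|->].
    apply: recursive_ext (rec_proj i) _ => x.
    by rewrite /G (tnth_nth 0) (tnth_nth 0).
  by apply: recursive_ext rc _ => x; rewrite /G (tnth_nth 0).
apply: recursive_ext (rec_comp rh rG) _ => x.
have -> : [tuple G j x | j < n.+1] = [tuple of c x :: x].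
  by apply: eq_from_tnth => j; rewrite tnth_mktuple.
by rewrite /h theadE behead_tuple_cons.
Qed.

End RecursiveTuples.

Lemma recursive_thead n : recursive (fun x : n.+1.-tuple nat => thead x).
Proof. exact: rec_proj. Qed.

Lemma recursive_behead n (f : n.-tuple nat -> nat) :
  recursive f -> recursive (fun x : n.+1.-tuple nat => f (behead_tuple x)).
Proof.
move=> rf; pose g (j : 'I_n) (x : n.+1.-tuple nat) := tnth x (lift ord0 j).
apply: recursive_ext (rec_comp rf (fun j => rec_proj (lift ord0 j))) _ => x.
congr (f _); apply: eq_from_tnth => j; rewrite tnth_mktuple.
by rewrite !(tnth_nth 0) /= nth_behead.
Qed.

Section RecursiveArithmetic.
Variable n : nat.
Implicit Types (f g : n.-tuple nat -> nat).

Lemma recursive_cond c f g : recursive c -> recursive f -> recursive g ->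
  recursive (fun x => if c x is 0 then f x else g x).
Proof.
move=> rc rf rg.
have := recursive_nat_rect (g := fun _ _ => g) rc rf.
move/(_ (recursive_behead (recursive_behead rg)))/recursive_ext; apply=> x.
by case: (c x).
Qed.

Lemma recursive_add f g : recursive f -> recursive g ->
  recursive (fun x => f x + g x).
Proof.
move=> rf rg; have := recursive_nat_rect (g := fun _ h _ => h.+1) rf rg.
move/(_ (recursive_succ (recursive_behead (@recursive_thead _)))).
by move/recursive_ext; apply=> x; elim: (f x) => //= m ->.
Qed.

Lemma recursive_pred f : recursive f -> recursive (fun x => (f x).-1).
Proof.
move=> rf; have := recursive_nat_rect (g := fun y _ _ => y) rf (recursive_const _ 0).
move/(_ (@recursive_thead _))/recursive_ext; apply=> x.
by case: (f x).
Qed.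

Lemma recursive_double f : recursive f -> recursive (fun x => (f x).*2).
Proof.
move=> rf; apply: recursive_ext (recursive_add rf rf) _ => x.
by rewrite addnn.
Qed.

End RecursiveArithmetic.

Section RecursiveCodes.
Variable n : nat.
Implicit Types (f g : n.-tuple nat -> nat).

Lemma recursive_sub f g : recursive f -> recursive g ->
  recursive (fun x => f x - g x).
Proof.
move=> rf rg; have := recursive_nat_rect (g := fun _ h _ => h.-1) rg rf.
move/(_ (recursive_pred (recursive_behead (@recursive_thead _)))).
by move/recursive_ext; apply=> x; elim: (g x) => [|m /= ->]; rewrite ?subn0 ?subnS.
Qed.

Lemma recursive_eq f g : recursive f -> recursive g ->
  recursive (fun x => nat_of_bool (f x == g x)).
Proof.
move=> rf rg.
have := recursive_cond (recursive_add (recursive_sub rf rg) (recursive_sub rg rf))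
  (recursive_const _ 1) (recursive_const _ 0).
move/recursive_ext; apply=> x; rewrite eqn_leq -!subn_eq0.
by case: (f x - g x) => [|a]; case: (g x - f x).
Qed.

Lemma recursive_odd f : recursive f -> recursive (fun x => nat_of_bool (odd (f x))).
Proof.
move=> rf; have := recursive_nat_rect
  (g := fun _ h _ => if h is 0 then 1 else 0) rf (recursive_const _ 0).
have r : recursive (fun x : n.+2.-tuple nat =>
    if thead (behead_tuple x) is 0 then 1 else 0).
  apply: recursive_cond (recursive_const _ _) (recursive_const _ _).
  exact: recursive_behead (@recursive_thead _).
move/(_ r)/recursive_ext; apply=> x.
by elim: (f x) => //= m ->; case: (odd m).
Qed.

End RecursiveCodes.

Section RecursiveHalf.
Variable n : nat.
Implicit Types (f g : n.-tuple nat -> nat).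

Lemma recursive_half f : recursive f -> recursive (fun x => (f x)./2).
Proof.
move=> rf; have := recursive_nat_rect
  (g := fun y h _ => odd y + h) rf (recursive_const _ 0).
have r : recursive (fun x : n.+2.-tuple nat =>
    odd (thead x) + thead (behead_tuple x)).
  apply: recursive_add (recursive_odd (@recursive_thead _)) _.
  exact: recursive_behead (@recursive_thead _).
move/(_ r)/recursive_ext; apply=> x.
by elim: (f x) => //= m ->; rewrite uphalf_half.
Qed.

End RecursiveHalf.

Section RecursiveSeqCodes.
Variable n : nat.
Implicit Types (f g : n.-tuple nat -> nat).

Definition code_cons (a c : nat) := CodeSeq.code (a :: CodeSeq.decode c).
Definition code_head (c : nat) := head 0 (CodeSeq.decode c).
Definition code_tail (c : nat) := CodeSeq.code (behead (CodeSeq.decode c)).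

Lemma recursive_code_cons f g : recursive f -> recursive g ->
  recursive (fun x => code_cons (f x) (g x)).
Proof.
move=> rf rg; have := recursive_nat_rect (g := fun _ h _ => h.*2) rf
  (recursive_succ (recursive_double rg)).
move/(_ (recursive_double (recursive_behead (@recursive_thead _)))).
move/recursive_ext; apply=> x; rewrite /code_cons /= CodeSeq.decodeK.
elim: (f x) => [|m /= ->]; rewrite ?mul1n //.
by rewrite expnS -mulnA mul2n.
Qed.

(** [CodeSeq.code (a :: s)] is [2 ^ a * (CodeSeq.code s).*2.+1], so the head of a sequence is the
    2-adic valuation of its code and is found by halving until an odd number appears. *)
Lemma iter_half_pow2 j k m : iter j half (2 ^ (j + k) * m) = 2 ^ k * m.
Proof.
elim: j => //= j IH in k m *.
by rewrite addSnnS IH expnS -mulnA mul2n doubleK.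
Qed.

Lemma code_head_half a s :
  iter a half (CodeSeq.code (a :: s)) = (CodeSeq.code s).*2.+1.
Proof. by rewrite /= -{2}[a]addn0 iter_half_pow2 mul1n. Qed.

Lemma code_head_even a s j : j < a ->
  odd (iter j half (CodeSeq.code (a :: s))) = false.
Proof.
move=> ja; rewrite /= -(subnKC ja) addSnnS iter_half_pow2.
by rewrite expnS -mulnA mul2n odd_double.
Qed.

Lemma recursive_iter_half f g : recursive f -> recursive g ->
  recursive (fun x => iter (f x) half (g x)).
Proof.
move=> rf rg; have := recursive_nat_rect (g := fun _ h _ => h./2) rf rg.
by move/(_ (recursive_half (recursive_behead (@recursive_thead _)))).
Qed.

End RecursiveSeqCodes.

Lemma decode_posP c : 0 < c -> CodeSeq.decode c =
  code_head c :: CodeSeq.decode (code_tail c).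
Proof.
rewrite /code_head /code_tail CodeSeq.codeK -{1}[c]CodeSeq.decodeK.
by case: (CodeSeq.decode c).
Qed.

Lemma recursive_code_head n (f : n.-tuple nat -> nat) :
  recursive f -> recursive (fun x => code_head (f x)).
Proof.
apply: recursive_app1.
(* [rec_mu] needs a zero for every parameter. Halving the code 0 never gives an odd number, so there
   [p] is set to 0 at once; the minimum 0 agrees with the default head of the empty sequence. *)
pose p (z : 2.-tuple nat) :=
  if thead (behead_tuple z) is 0 then 0
  else if nat_of_bool (odd (iter (thead z) half (thead (behead_tuple z))))
       is 0 then 1 else 0.
have r0 := @recursive_thead 1.
have r1 := recursive_behead (@recursive_thead 0).
have rp : recursive p.
  apply: (recursive_cond r1 (recursive_const _ _)).
  apply: recursive_cond (recursive_const _ _) (recursive_const _ _).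
  exact: recursive_odd (recursive_iter_half r0 r1).
have pE y (x : 1.-tuple nat) : p [tuple of y :: x] =
    if thead x is 0 then 0
    else if nat_of_bool (odd (iter y half (thead x))) is 0 then 1 else 0.
  by rewrite /p theadE behead_tuple_cons.
apply: (rec_mu rp) => [x|x y]; rewrite pE; case: (posnP (thead x)) => [-> //|].
  move=> x_gt0; rewrite -[X in iter _ _ X]CodeSeq.decodeK (decode_posP x_gt0).
  by rewrite code_head_half /= odd_double; case: (thead x).
move=> x_gt0 y_lt; rewrite -[X in iter _ _ X]CodeSeq.decodeK (decode_posP x_gt0).
by rewrite code_head_even //; case: (thead x) x_gt0.
Qed.

(** Halving as often as the head says leaves twice the code of the tail plus one, and one more
    halving leaves that code. *)
Lemma recursive_code_tail n (f : n.-tuple nat -> nat) :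
  recursive f -> recursive (fun x => code_tail (f x)).
Proof.
move=> rf.
apply: recursive_ext (recursive_half
  (recursive_iter_half (recursive_code_head rf) rf)) _ => x.
case: (posnP (f x)) => [-> //|x_gt0].
rewrite -[X in iter _ _ X]CodeSeq.decodeK (decode_posP x_gt0) code_head_half.
by rewrite CodeSeq.decodeK /= uphalf_double.
Qed.

(** * Computable functions between countable types *)

(** [F] is prescribed on codes of elements of [T] only and may take any values elsewhere. *)
Definition computable (T U : countType) (f : T -> U) : Prop :=
  exists2 F : nat -> nat, recursive (fun x : 1.-tuple nat => F (thead x)) &
    forall t, F (pickle t) = pickle (f t).

Lemma code_consE a s : code_cons a (CodeSeq.code s) = CodeSeq.code (a :: s).
Proof. by rewrite /code_cons CodeSeq.codeK. Qed.
Lemma code_headE s : code_head (CodeSeq.code s) = head 0 s.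
Proof. by rewrite /code_head CodeSeq.codeK. Qed.
Lemma code_tailE s : code_tail (CodeSeq.code s) = CodeSeq.code (behead s).
Proof. by rewrite /code_tail CodeSeq.codeK. Qed.

Lemma pickle_pair (T U : countType) (x : T * U) :
  pickle x = CodeSeq.code [:: pickle x.1; pickle x.2].
Proof. by []. Qed.

Lemma pickle_cons (T : countType) (x : T) s :
  pickle (x :: s) = CodeSeq.code (pickle x :: map pickle s).
Proof. by []. Qed.

Section Computable.
Variable X : countType.

Lemma computable_ext (T : countType) (f g : X -> T) :
  computable f -> f =1 g -> computable g.
Proof. by move=> cf /funext <-. Qed.

Lemma computable_id : computable (fun x : X => x).
Proof. by exists id => //; exact: recursive_thead. Qed.

Lemma computable_comp (T U : countType) (g : T -> U) (f : X -> T) :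
  computable g -> computable f -> computable (fun x => g (f x)).
Proof.
move=> [G rG GE] [F rF FE]; exists (fun n => G (F n)) => [|t].
  exact: recursive_app1.
by rewrite FE GE.
Qed.

Lemma computable_const (T : countType) (c : T) : computable (fun _ : X => c).
Proof. by exists (fun=> pickle c) => //; exact: recursive_const. Qed.

Lemma computable_pair (T U : countType) (f : X -> T) (g : X -> U) :
  computable f -> computable g -> computable (fun x => (f x, g x)).
Proof.
move=> [F rF FE] [G rG GE].
exists (fun n => code_cons (F n) (code_cons (G n) 0)) => [|x].
  apply: recursive_code_cons => //.
  by apply: recursive_code_cons => //; exact: recursive_const.
by rewrite FE GE (code_consE _ [::]) code_consE.
Qed.

Lemma computable_fst (T U : countType) (f : X -> T * U) :
  computable f -> computable (fun x => (f x).1).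
Proof.
move=> [F rF FE]; exists (fun n => code_head (F n)) => [|x].
  exact: recursive_code_head.
by rewrite FE pickle_pair code_headE.
Qed.

Lemma computable_snd (T U : countType) (f : X -> T * U) :
  computable f -> computable (fun x => (f x).2).
Proof.
move=> [F rF FE]; exists (fun n => code_head (code_tail (F n))) => [|x].
  by apply: recursive_code_head; exact: recursive_code_tail.
by rewrite FE pickle_pair code_tailE code_headE.
Qed.

Lemma computable_cons (T : countType) (f : X -> T) (g : X -> seq T) :
  computable f -> computable g -> computable (fun x => f x :: g x).
Proof.
move=> [F rF FE] [G rG GE].
exists (fun n => code_cons (F n) (G n)) => [|x].
  exact: recursive_code_cons.
by rewrite FE GE code_consE.
Qed.

Lemma computable_some (T : countType) (f : X -> T) :
  computable f -> computable (fun x => Some (f x)).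
Proof.
move=> [F rF FE]; exists (fun n => code_cons (F n) 0) => [|x].
  by apply: recursive_code_cons => //; exact: recursive_const.
by rewrite FE (code_consE _ [::]).
Qed.

Lemma computable_bool_case (T : countType) (b : X -> bool) (f g : X -> T) :
  computable b -> computable f -> computable g ->
  computable (fun x => if b x then f x else g x).
Proof.
move=> [B rB BE] [F rF FE] [G rG GE].
exists (fun n => if B n is 0 then G n else F n) => [|x].
  exact: recursive_cond.
by rewrite BE FE GE; case: (b x).
Qed.

Lemma computable_eq (T : countType) (f g : X -> T) :
  computable f -> computable g -> computable (fun x => f x == g x).
Proof.
move=> [F rF FE] [G rG GE].
exists (fun n => nat_of_bool (F n == G n)) => [|x]; first exact: recursive_eq.
by rewrite FE GE (inj_eq (pcan_inj (@pickleK T))); case: eqP.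
Qed.

Lemma computable_app2 (T U V : countType) (f : T -> U -> V) (a : X -> T)
    (b : X -> U) :
  computable (fun z : T * U => f z.1 z.2) -> computable a -> computable b ->
  computable (fun x => f (a x) (b x)).
Proof.
move=> cf ca cb; exact: (computable_comp cf (computable_pair ca cb)).
Qed.

Lemma computable_app3 (T U V W : countType) (f : T -> U -> V -> W) (a : X -> T)
    (b : X -> U) (c : X -> V) :
  computable (fun z : T * (U * V) => f z.1 z.2.1 z.2.2) ->
  computable a -> computable b -> computable c ->
  computable (fun x => f (a x) (b x) (c x)).
Proof.
move=> cf ca cb cc.
exact: (computable_comp cf (computable_pair ca (computable_pair cb cc))).
Qed.

End Computable.

Section ComputableCases.
Variable X : countType.

(** A finite nest of equality tests on [t x]. The programs for the various [t] may be unrelated, so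
    data picked by classical choice is allowed as long as it is indexed by a finite type. *)
Lemma computable_fin (T : finType) (U : countType) (f : X -> T -> U) (t : X -> T) :
  (forall t, computable (f^~ t)) -> computable t ->
  computable (fun x => f x (t x)).
Proof.
move=> cf ct; case: (pickP (@predT T)) => [t0 _|T0]; last first.
  (* If [T] is empty then so is [X], because of [t]. *)
  by exists (fun n => n); [exact: recursive_thead | move=> x; have := T0 (t x)].
have c (s : seq T) : computable (fun x => f x (if t x \in s then t x else t0)).
  elim: s => [|a s IH]; first exact: cf.
  have := computable_bool_case (computable_eq ct (computable_const _ a)) (cf a) IH.
  move/computable_ext; apply=> x; rewrite in_cons.
  by case: eqVneq => [->|].
by apply: computable_ext (c (enum T)) _ => x; rewrite mem_enum.
Qed.

Lemma computable_seq_case (T U : countType) (l : X -> seq T) (f : X -> U)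
    (g : X -> T -> seq T -> U) :
  computable l -> computable f ->
  computable (fun z : X * (T * seq T) => g z.1 z.2.1 z.2.2) ->
  computable (fun x => if l x is a :: s then g x a s else f x).
Proof.
move=> [L rL LE] [F rF FE] [G rG GE].
(* From the code [n] of [x], [H n] assembles the code of [(x, (a, s))]. The test [L n = 0] singles
   out the empty list, as every other code is positive. *)
pose H n := code_cons n (code_cons (code_cons (code_head (L n))
  (code_cons (code_tail (L n)) 0)) 0).
have rH : recursive (fun x : 1.-tuple nat => H (thead x)).
  apply: recursive_code_cons (recursive_thead _) _.
  apply: recursive_code_cons (recursive_const _ _).
  apply: (recursive_code_cons (recursive_code_head rL)).
  exact: recursive_code_cons (recursive_code_tail rL) (recursive_const _ _).
exists (fun n => if L n is 0 then F n else G (H n)) => [|x].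
  by apply: recursive_cond => //; apply: recursive_app1.
rewrite LE FE /H; case: (l x) (LE x) => [|a s] //= lE.
rewrite -(GE (x, (a, s))) lE pickle_cons.
rewrite code_headE code_tailE !(code_consE _ [::]) !code_consE.
case E : (CodeSeq.code _) => //.
by move/(congr1 CodeSeq.decode): E; rewrite CodeSeq.codeK.
Qed.

Lemma computable_option_case (T U : countType) (o : X -> option T) (f : X -> U)
    (g : X -> T -> U) :
  computable o -> computable f -> computable (fun z : X * T => g z.1 z.2) ->
  computable (fun x => if o x is Some a then g x a else f x).
Proof.
move=> [O rO OE] cf cg.
have cl : computable (fun x => seq_of_opt (o x)).
  (* An option and the list of its at most one element have the same code. *)
  by exists O => // x; rewrite OE; case: (o x).
have := @computable_seq_case T U _ f (fun x a _ => g x a) cl cf.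
have -> : (fun z : X * (T * seq T) => g z.1 z.2.1) =
  (fun z => (fun y : X * T => g y.1 y.2) (z.1, z.2.1)) by [].
have c1 := computable_fst (@computable_id (X * (T * seq T))%type).
have c2 := computable_fst (computable_snd (@computable_id (X * (T * seq T))%type)).
move/(_ (computable_comp cg (computable_pair c1 c2)))/computable_ext.
by apply=> x; case: (o x).
Qed.

Lemma computable_iter (S : countType) (n : X -> nat) (f : X -> S -> S)
    (b : X -> S) :
  computable n -> computable (fun z : X * S => f z.1 z.2) -> computable b ->
  computable (fun x => iter (n x) (f x) (b x)).
Proof.
move=> [N rN NE] [F rF FE] [B rB BE].
pose g (y h : nat) (x : 1.-tuple nat) :=
  F (code_cons (thead x) (code_cons h 0)).
exists (fun m => nat_rect (fun=> nat) (B m) (fun _ h =>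
  F (code_cons m (code_cons h 0))) (N m)) => [|x].
  apply: (recursive_nat_rect (g := g) rN rB).
  apply: recursive_app1 rF _.
  apply: recursive_code_cons.
    exact: (recursive_behead (recursive_behead (@recursive_thead 0))).
  apply: recursive_code_cons (recursive_const _ _).
  exact: (recursive_behead (@recursive_thead 1)).
rewrite NE BE [pickle (n x)]/=; elim: (n x) => //= m ->.
by rewrite -(FE (x, _)) (code_consE _ [::]) code_consE.
Qed.

(** Folding over a list needs an iteration count computed beforehand; the code of the list is one
    that is large enough. *)
Lemma size_le_pickle (T : countType) (s : seq T) : size s <= pickle s.
Proof.
elim: s => // a s IH; rewrite pickle_cons /= -[CodeSeq.code _]/(pickle s).
rewrite -[(size s).+1]mul1n leq_mul ?expn_gt0 // ltnS.
by rewrite (leq_trans IH) // -addnn leq_addr.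
Qed.

End ComputableCases.

Ltac computability := repeat match goal with
  | |- computable (fun x => x) => exact: computable_id
  | |- computable fst => exact: (computable_fst (f := fun x => x)
                                   (computable_id _))
  | |- computable snd => exact: (computable_snd (f := fun x => x)
                                   (computable_id _))
  | |- computable _ => assumption
  | |- computable (fun _ => ?c) => exact: (computable_const _ c)
  | |- computable (fun x => fst (@?f x)) => apply: (computable_fst (f := f))
  | |- computable (fun x => snd (@?f x)) => apply: (computable_snd (f := f))
  | |- computable (fun x => pair (@?f x) (@?g x)) =>
      apply: (computable_pair (f := f) (g := g))
  | |- computable (fun x => cons (@?f x) (@?g x)) =>
      apply: (computable_cons (f := f) (g := g))
  | |- computable (fun x => Some (@?f x)) => apply: (computable_some (f := f))
  | |- computable (fun x => if _ then _ else _) =>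
      apply: computable_bool_case
  | |- computable (fun x => eq_op (@?f x) (@?g x)) =>
      apply: (computable_eq (f := f) (g := g))
  end.

Section ComputableSeq.
Variables (X T : countType).

(** The step consumes one letter and is the identity once the list is empty, so the iterations in
    excess of the length do no harm. *)
Lemma computable_foldl (S : countType) (f : X -> S -> T -> S)
    (b : X -> S) (l : X -> seq T) :
  computable (fun z : X * (S * T) => f z.1 z.2.1 z.2.2) ->
  computable b -> computable l ->
  computable (fun x => foldl (f x) (b x) (l x)).
Proof.
move=> cf cb cl.
pose g x (u : S * seq T) : S * seq T :=
  if u.2 is a :: s then (f x u.1 a, s) else u.
have cg : computable (fun z : X * (S * seq T) => g z.1 z.2).
  apply: computable_seq_case; computability.
  by apply: (computable_app3 (f := f)); computability.
have cn : computable (fun x => pickle (l x)).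
  by case: cl => L rL LE; exists L.
have := computable_fst (computable_iter cn cg (computable_pair cb cl)).
move/computable_ext; apply=> x.
have fold n s c : size s <= n -> (iter n (g x) (c, s)).1 = foldl (f x) c s.
  elim: n s c => [|n IH] [|a s] // c; last by move=> sn; rewrite iterSr IH.
  by rewrite iterSr => _; apply: IH.
exact: fold (size_le_pickle _).
Qed.

End ComputableSeq.

Section ComputableSeqOps.
Variables (X T : countType).
Implicit Types l : X -> seq T.

Lemma computable_rev l :
  computable l -> computable (fun x => rev (l x)).
Proof.
move=> cl; have := @computable_foldl X T (seq T) (fun _ s a => a :: s) (fun=> [::]) l.
move/(_ _ _ cl)/computable_ext; apply; computability.
by move=> x; rewrite -[in LHS](revK (l x)) foldl_rev; elim: (rev _) => //= a s ->.
Qed.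

Lemma computable_foldr (S : countType) (f : X -> T -> S -> S) (b : X -> S) l :
  computable (fun z : X * (T * S) => f z.1 z.2.1 z.2.2) ->
  computable b -> computable l ->
  computable (fun x => foldr (f x) (b x) (l x)).
Proof.
move=> cf cb cl.
have := computable_foldl (f := fun x s a => f x a s) _ cb (computable_rev cl).
have c : computable (fun z : X * (S * T) => f z.1 z.2.2 z.2.1).
  by apply: (computable_app3 (f := f)); computability.
by move/(_ c)/computable_ext; apply=> x; rewrite -foldl_rev.
Qed.

Lemma computable_cat l1 l2 :
  computable l1 -> computable l2 -> computable (fun x => l1 x ++ l2 x).
Proof.
move=> c1 c2; have := computable_foldr (f := fun _ a s => a :: s) _ c2 c1.
have c : computable (fun z : X * (T * seq T) => z.2.1 :: z.2.2) by computability.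
by move/(_ c)/computable_ext; apply=> x; elim: (l1 x) => //= a s ->.
Qed.

Lemma computable_has (p : X -> T -> bool) l :
  computable (fun z : X * T => p z.1 z.2) -> computable l ->
  computable (fun x => has (p x) (l x)).
Proof.
move=> cp cl.
have c : computable (fun z : X * (T * bool) => if p z.1 z.2.1 then true else z.2.2).
  by computability; apply: (computable_app2 (f := p)); computability.
have := computable_foldr (f := fun x a b => if p x a then true else b) c
  (computable_const _ false) cl.
by move/computable_ext; apply=> x; elim: (l x) => //= a s ->; case: (p x a).
Qed.

Lemma computable_all (p : X -> T -> bool) l :
  computable (fun z : X * T => p z.1 z.2) -> computable l ->
  computable (fun x => all (p x) (l x)).
Proof.
move=> cp cl.
have c : computable (fun z : X * (T * bool) => if p z.1 z.2.1 then z.2.2 else false).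
  by computability; apply: (computable_app2 (f := p)); computability.
have := computable_foldr (f := fun x a b => if p x a then b else false) c
  (computable_const _ true) cl.
by move/computable_ext; apply=> x; elim: (l x) => //= a s ->; case: (p x a).
Qed.

Lemma computable_mem (a : X -> T) l :
  computable a -> computable l -> computable (fun x => a x \in l x).
Proof.
move=> ca cl; have := computable_has (p := fun x b => b == a x) _ cl.
have c : computable (fun z : X * T => z.2 == a z.1).
  by computability; apply: (computable_comp ca); computability.
by move/(_ c)/computable_ext; apply=> x; rewrite has_pred1.
Qed.

Lemma computable_map (U : countType) (f : X -> T -> U) l :
  computable (fun z : X * T => f z.1 z.2) -> computable l ->
  computable (fun x => [seq f x a | a <- l x]).
Proof.
move=> cf cl.
have c : computable (fun z : X * (T * seq U) => f z.1 z.2.1 :: z.2.2).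
  by computability; apply: (computable_app2 (f := f)); computability.
have := computable_foldr (f := fun x a s => f x a :: s) c (computable_const _ [::]) cl.
by move/computable_ext; apply=> x; elim: (l x) => //= a s ->.
Qed.

Lemma computable_ohead l : computable l -> computable (fun x => ohead (l x)).
Proof.
move=> cl; have c : computable (fun z : X * (T * seq T) => Some z.2.1) by computability.
have := computable_seq_case (g := fun _ a _ => Some a) cl (computable_const _ None) c.
by move/computable_ext; apply=> x; case: (l x).
Qed.

Lemma computable_behead l : computable l -> computable (fun x => behead (l x)).
Proof.
move=> cl; have c : computable (fun z : X * (T * seq T) => z.2.2) by computability.
have := computable_seq_case (g := fun _ _ s => s) cl (computable_const _ [::]) c.
by move/computable_ext; apply=> x; case: (l x).
Qed.

End ComputableSeqOps.

Lemma computable_flatten (X T : countType) (l : X -> seq (seq T)) :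
  computable l -> computable (fun x => flatten (l x)).
Proof.
move=> cl.
have c : computable (fun z : X * (seq T * seq T) => z.2.1 ++ z.2.2).
  by apply: computable_cat; computability.
exact: (computable_foldr (f := fun _ s t => s ++ t) c (computable_const _ [::]) cl).
Qed.

Lemma computable_filter (X T : countType) (p : X -> T -> bool) (l : X -> seq T) :
  computable (fun z : X * T => p z.1 z.2) -> computable l ->
  computable (fun x => [seq a <- l x | p x a]).
Proof.
move=> cp cl.
have c : computable (fun z : X * (T * seq T) => if p z.1 z.2.1 then z.2.1 :: z.2.2
    else z.2.2).
  by computability; apply: (computable_app2 (f := p)); computability.
exact: (computable_foldr (f := fun x a s => if p x a then a :: s else s) c
  (computable_const _ [::]) cl).
Qed.

(** A finite table is a program, however [f] was obtained. *)
Lemma computable_finfun (T : finType) (U : countType) (f : T -> U) :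
  computable f.
Proof.
apply: (computable_fin (f := fun _ => f)); computability.
by move=> t; computability.
Qed.

Lemma computable_and (X : countType) (p q : X -> bool) :
  computable p -> computable q -> computable (fun x => p x && q x).
Proof.
by move=> cp cq; apply: computable_bool_case => //; computability.
Qed.

(** * Semidecidability *)

(** Partial enumerations allow [T] to be empty and indices to denote nothing. *)
Definition enumerable (T : countType) : Prop :=
  exists2 d : nat -> option T, computable d & forall y, exists n, d n = Some y.

Lemma computable_code_head : computable (code_head : nat -> nat).
Proof.
by exists code_head => //; apply: recursive_code_head (recursive_thead _).
Qed.

Lemma computable_code_tail : computable (code_tail : nat -> nat).
Proof.
by exists code_tail => //; apply: recursive_code_tail (recursive_thead _).
Qed.

Lemma computable_decode : computable CodeSeq.decode.
Proof.
exists id; first exact: recursive_thead.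
move=> n; transitivity (CodeSeq.code (CodeSeq.decode n)); first by rewrite CodeSeq.decodeK.
by congr CodeSeq.code; rewrite map_id.
Qed.

Definition unpair (n : nat) : nat * nat := (code_head n, code_head (code_tail n)).

Lemma computable_unpair : computable unpair.
Proof.
apply: computable_pair computable_code_head _.
exact: computable_comp computable_code_head computable_code_tail.
Qed.

Lemma unpairK a b : unpair (CodeSeq.code [:: a; b]) = (a, b).
Proof. by rewrite /unpair code_headE code_tailE code_headE. Qed.

Lemma enumerable_comp (T U : countType) (f : T -> U) :
  computable f -> (forall y, exists x, f x = y) -> enumerable T -> enumerable U.
Proof.
move=> cf surj [d cd dE].
exists (fun n => if d n is Some x then Some (f x) else None) => [|y].
  apply: computable_option_case => //; computability.
  by apply: (computable_comp cf); computability.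
by have [x <-] := surj y; have [n dn] := dE x; exists n; rewrite dn.
Qed.

Lemma enumerable_fin (T : finType) : enumerable T.
Proof.
pose d n := ohead (iter n behead (enum T)).
exists d => [|y].
  apply: computable_ohead; apply: computable_iter; computability.
  by apply: computable_behead; computability.
exists (index y (enum T)).
have -> : d (index y (enum T)) = ohead (drop (index y (enum T)) (enum T)).
  by congr ohead; elim: (index _ _) => [|m /= ->]; rewrite ?drop0 // -drop1 drop_drop.
by rewrite (drop_nth y) ?index_mem ?mem_enum //= nth_index ?mem_enum.
Qed.

Lemma enumerable_pair (T U : countType) :
  enumerable T -> enumerable U -> enumerable (T * U)%type.
Proof.
move=> [d cd dE] [e ce eE].
exists (fun n => if d (unpair n).1 is Some x then
    if e (unpair n).2 is Some y then Some (x, y) else None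
  else None) => [|[x y]].
  have cu := computable_unpair.
  apply: computable_option_case; computability.
    by apply: (computable_comp cd); computability.
  apply: computable_option_case; computability.
  apply: (computable_comp ce); computability.
  by apply: (computable_comp cu); computability.
have [n dn] := dE x; have [m em] := eE y.
by exists (CodeSeq.code [:: n; m]); rewrite unpairK dn em.
Qed.

Lemma enumerable_seq (T : countType) : enumerable T -> enumerable (seq T).
Proof.
move=> [d cd dE].
exists (fun n => Some (flatten [seq if d m is Some x then [:: x] else [::]
                               | m <- CodeSeq.decode n])) => [|s].
  have cD := computable_decode.
  computability; apply: computable_flatten; apply: computable_map => //.
  apply: computable_option_case; computability.
  by apply: (computable_comp cd); computability.
suff [l <-] : exists l, flatten
    [seq if d m is Some x then [:: x] else [::] | m <- l] = s.
  by exists (CodeSeq.code l); rewrite CodeSeq.codeK.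
elim: s => [|x s [l <-]]; first by exists [::].
by have [n dn] := dE x; exists (n :: l); rewrite /= dn.
Qed.

Lemma enumerable_option (T : countType) : enumerable T -> enumerable (option T).
Proof.
move=> eT; apply: (enumerable_comp (f := @ohead T)) (enumerable_seq eT).
  by apply: computable_ohead; computability.
by move=> [x|]; [exists [:: x] | exists [::]].
Qed.

Definition semidecidable (X : countType) (P : X -> Prop) : Prop :=
  exists2 p : X -> nat -> bool, computable (fun z : X * nat => p z.1 z.2) &
    forall x, P x <-> exists n, p x n.

Section Semidecidable.
Variable X : countType.

Lemma semidecidable_iff (P Q : X -> Prop) :
  semidecidable P -> (forall x, P x <-> Q x) -> semidecidable Q.
Proof. by move=> [p cp pE] PQ; exists p => // x; rewrite -PQ. Qed.

Lemma semidecidable_computable (p : X -> bool) :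
  computable p -> semidecidable (fun x => p x).
Proof.
move=> cp; exists (fun x _ => p x) => [|x]; last by split=> [|[]//]; exists 0.
by apply: (computable_comp cp); computability.
Qed.

Lemma semidecidable_comp (Y : countType) (f : X -> Y) (P : Y -> Prop) :
  computable f -> semidecidable P -> semidecidable (fun x => P (f x)).
Proof.
move=> cf [p cp pE]; exists (fun x => p (f x)) => [|x]; last exact: pE.
apply: (computable_app2 (f := p)) => //; computability.
by apply: (computable_comp cf); computability.
Qed.

(** Dovetailing: one number encodes both the index of a witness and the stage at which the witness
    is accepted. *)
Lemma semidecidable_ex (Y : countType) (P : X -> Y -> Prop) :
  enumerable Y -> semidecidable (fun z : X * Y => P z.1 z.2) ->
  semidecidable (fun x => exists y, P x y).
Proof.
move=> [d cd dE] [p cp pE].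
exists (fun x n => if d (unpair n).1 is Some y then p (x, y) (unpair n).2
                   else false) => [|x].
  have cu := computable_unpair.
  apply: computable_option_case; computability.
    apply: (computable_comp cd); computability.
    by apply: (computable_comp cu); computability.
  apply: (computable_app2 (f := p)); computability.
  by apply: (computable_comp cu); computability.
split=> [[y /(pE (x, y))[m pm]]|[n]].
  by have [n dn] := dE y; exists (CodeSeq.code [:: n; m]); rewrite unpairK dn.
case: (d _) => // y py; exists y; by apply/(pE (x, y)); exists (unpair n).2.
Qed.

Lemma semidecidable_and (P Q : X -> Prop) :
  semidecidable P -> semidecidable Q -> semidecidable (fun x => P x /\ Q x).
Proof.
move=> [p cp pE] [q cq qE].
exists (fun x n => p x (unpair n).1 && q x (unpair n).2) => [|x].
  have cu := computable_unpair.
  apply: computable_and.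
    apply: (computable_app2 (f := p)); computability.
    by apply: (computable_comp cu); computability.
  apply: (computable_app2 (f := q)); computability.
  by apply: (computable_comp cu); computability.
rewrite pE qE; split=> [[[n pn] [m qm]]|[n /andP[pn qn]]].
  by exists (CodeSeq.code [:: n; m]); rewrite unpairK pn.
by split; [exists (unpair n).1 | exists (unpair n).2].
Qed.

Lemma semidecidable_or (P Q : X -> Prop) :
  semidecidable P -> semidecidable Q -> semidecidable (fun x => P x \/ Q x).
Proof.
move=> [p cp pE] [q cq qE].
exists (fun x n => if p x n then true else q x n) => [|x]; first by computability.
rewrite pE qE; split=> [[[n pn]|[n qn]]|[n]].
- by exists n; rewrite pn.
- by exists n; rewrite qn if_same.
- by case: ifP => [pn _|_ qn]; [left|right]; exists n.
Qed.

Lemma semidecidable_forall (I : finType) (P : I -> X -> Prop) :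
  (forall i, semidecidable (P i)) -> semidecidable (fun x => forall i, P i x).
Proof.
move=> sP.
suff s (l : seq I) : semidecidable (fun x => forall i, i \in l -> P i x).
  apply: semidecidable_iff (s (enum I)) _ => x.
  by split=> Px i; [apply: Px; rewrite mem_enum | move=> _].
elim: l => [|a l IH].
  apply: (semidecidable_iff (semidecidable_computable (p := xpredT) _)).
    by computability.
  by [].
apply: semidecidable_iff (semidecidable_and (sP a) IH) _ => x.
split=> [[Pa Pl] i|Pl]; first by rewrite in_cons => /orP[/eqP->|/Pl].
by split=> [|i il]; apply: Pl; rewrite in_cons ?eqxx ?il ?orbT.
Qed.

End Semidecidable.

(** Post's theorem. By excluded middle one of the two searches succeeds, so minimization over the
    stage is total; at the stage found, the answer of [p] tells which one succeeded. *)
Lemma recursive_set_semidecidable (D : set nat) :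
  semidecidable D -> semidecidable (fun n => ~ D n) -> recursive_set D.
Proof.
move=> [p cp pE] [q cq qE].
have ex n : exists m, p n m || q n m.
  by case: (pselect (D n)) => [/pE|/qE] [m h]; exists m; rewrite h ?orbT.
pose h n := ex_minn (ex n).
have cr : computable (fun z : nat * nat => if p z.2 z.1 then 0
    else if q z.2 z.1 then 0 else 1).
  computability; first by apply: (computable_app2 (f := p)); computability.
  by apply: (computable_app2 (f := q)); computability.
have rh : recursive (fun x : 1.-tuple nat => h (thead x)).
  case: cr => F rF FE.
  have r : recursive (fun z : 2.-tuple nat =>
      F (code_cons (thead z) (code_cons (thead (behead_tuple z)) 0))).
    apply: recursive_app1 => //; apply: recursive_code_cons (@recursive_thead _) _.
    apply: recursive_code_cons (recursive_const _ _).
    exact: recursive_behead (@recursive_thead 0).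
  have rE y (x : 1.-tuple nat) : F (code_cons (thead [tuple of y :: x])
      (code_cons (thead (behead_tuple [tuple of y :: x])) 0)) =
      if p (thead x) y then 0 else if q (thead x) y then 0 else 1.
    rewrite theadE behead_tuple_cons (code_consE _ [::]) code_consE.
    exact: FE (y, thead x).
  apply: (rec_mu r) => [x|x y]; rewrite rE /h; case: ex_minnP => m.
    by case: (p _ _) => //= ->.
  move=> _ min ym; have := contra (min y); rewrite -ltnNge => /(_ ym).
  by rewrite negb_or => /andP[/negbTE-> /negbTE->].
case: cp => F rF FE.
apply: recursive_ext (recursive_app1 rF (f := fun x => code_cons (thead x)
  (code_cons (h (thead x)) 0)) _) _ => [|x].
  apply: recursive_code_cons (@recursive_thead _) _.
  exact: recursive_code_cons rh (recursive_const _ _).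
rewrite (code_consE _ [::]) code_consE (FE (thead x, h (thead x))).
rewrite /h; case: ex_minnP => m; case pm : (p _ _) => /= qm _.
  by rewrite asboolT //; apply/pE; exists m.
by rewrite asboolF //; apply/qE; exists m.
Qed.

(** * Derivations in a presentation *)

Lemma letter_invK (B : Type) : involutive (@letter_inv B).
Proof. by case=> b s; rewrite /letter_inv /= negbK. Qed.

Lemma word_inv_cat (B : Type) (u v : word B) :
  word_inv (u ++ v) = word_inv v ++ word_inv u.
Proof. by rewrite /word_inv map_cat rev_cat. Qed.

Lemma word_inv_cons (B : Type) (l : B * bool) (w : word B) :
  word_inv (l :: w) = word_inv w ++ [:: letter_inv l].
Proof. by rewrite /word_inv /= rev_cons cats1. Qed.

Lemma word_invK (B : Type) : involutive (@word_inv B).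
Proof.
elim=> // l w IH.
by rewrite word_inv_cons word_inv_cat IH /= letter_invK.
Qed.

Definition congruence (B : Type) (P : word B -> word B -> Prop) : Prop :=
  [/\ forall u, P u u, forall u v, P u v -> P v u,
      forall u v w, P u v -> P v w -> P u w &
      forall x y u v, P u v -> P (x ++ u ++ y) (x ++ v ++ y)].

Lemma congr_gen_min (B : Type) (E : set (word B * word B))
    (P : word B -> word B -> Prop) :
  congruence P -> (forall u v, E (u, v) -> P u v) ->
  forall u v, congr_gen E u v -> P u v.
Proof.
move=> [Pr Ps Pt Pc] EP u v; elim=> {u v} //.
- by move=> u v _; exact: Ps.
- by move=> u v w _ uv _ vw; exact: Pt uv vw.
- by move=> x y u v _; exact: Pc.
Qed.

(** The Wagner congruence is itself generated by pairs, so minimality is used twice and leaves only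
    the two families of Wagner pairs and [S] to check. *)
Lemma pres_congr_min (B : choiceType) (S : set (word B * word B))
    (P : word B -> word B -> Prop) :
  congruence P ->
  (forall w, P (w ++ word_inv w ++ w) w) ->
  (forall u v, P (u ++ word_inv u ++ v ++ word_inv v)
                 (v ++ word_inv v ++ u ++ word_inv u)) ->
  (forall u v, S (u, v) -> P u v) ->
  forall u v, pres_congr S u v -> P u v.
Proof.
move=> cP Pw Pc PS; apply: congr_gen_min => // u v [|]; last exact: PS.
rewrite /wagner /=; apply: congr_gen_min => // {}u {}v.
by case=> [[w [-> ->]]|[x [y [-> ->]]]].
Qed.

Section Derivations.
Variables (B : finType) (rs : seq (word B * word B)).

Let W : countType := seq (B * bool).

Lemma computable_word_inv (X : countType) (f : X -> W) :
  computable f -> computable (fun x => word_inv (f x) : W).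
Proof.
move=> cf; apply: computable_rev; apply: computable_map => //.
by apply: (computable_comp (computable_finfun (@letter_inv B))); computability.
Qed.

(** The indices 0 and 1 stand for the two Wagner schemes, instantiated by the words in [p]; the
    others for the relations in [rs]. Finitely many indices make the choice of a rule a finite case
    distinction. *)
Definition rule (j : 'I_(size rs).+2) (p : W * W) : W * W :=
  match val j with
  | 0 => (p.1 ++ word_inv p.1 ++ p.1, p.1)
  | 1 => (p.1 ++ word_inv p.1 ++ p.2 ++ word_inv p.2,
          p.2 ++ word_inv p.2 ++ p.1 ++ word_inv p.1)
  | k.+2 => nth ([::], [::]) rs k
  end.

Definition rewrite_step : countType :=
  (W * W * (bool * ('I_(size rs).+2 * (W * W))))%type.

(** A step that does not fit leaves the word alone, so every list of steps is a valid derivation and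
    folding replaces a validity check. *)
Definition apply_step (u : W) (e : rewrite_step) : W :=
  let r := rule e.2.2.1 e.2.2.2 in
  let p := if e.2.1 then r.1 else r.2 in
  let q := if e.2.1 then r.2 else r.1 in
  if u == e.1.1 ++ p ++ e.1.2 then e.1.1 ++ q ++ e.1.2 else u.

Lemma computable_rule : computable (fun z : 'I_(size rs).+2 * (W * W) => rule z.1 z.2).
Proof.
apply: (computable_fin (f := fun z j => rule j z.2)); computability.
move=> j; rewrite /rule; case: (val j) => [|[|k]]; computability;
  by repeat (apply: computable_cat || apply: computable_word_inv ||
    computability).
Qed.

Lemma computable_apply_step (X : countType) (f : X -> W) (g : X -> rewrite_step) :
  computable f -> computable g -> computable (fun x => apply_step (f x) (g x)).
Proof.
move=> cf cg; rewrite /apply_step.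
have cr : computable (fun x => rule (g x).2.2.1 (g x).2.2.2).
  by apply: (computable_app2 (f := rule)) computable_rule _ _; computability.
by computability; repeat (apply: computable_cat || computability).
Qed.

Let S : set (word B * word B) := [set` rs].

Lemma rule_sound j p : pres_congr S (rule j p).1 (rule j p).2.
Proof.
rewrite /rule; case: j => -[|[|k]] /= kr.
- by apply/congr_base; left; apply: congr_base; left; exists p.1.
- by apply/congr_base; left; apply: congr_base; right; exists p.1, p.2.
- apply/congr_base; right; rewrite /S /= -surjective_pairing.
  by apply: mem_nth.
Qed.

Lemma apply_step_sound u e : pres_congr S u (apply_step u e).
Proof.
rewrite /apply_step; case: eqP => [->|_]; last exact: congr_refl.
apply: congr_ctx; case: e.2.1; first exact: rule_sound.
by apply: congr_sym; exact: rule_sound.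
Qed.

Definition derives (u v : W) : Prop := exists l, foldl apply_step u l = v.

Lemma derives_step x y p q :
  (exists j z, (p, q) = rule j z \/ (q, p) = rule j z) ->
  derives (x ++ p ++ y) (x ++ q ++ y).
Proof.
move=> [j [z [] /esym E]].
  by exists [:: (x, y, (true, (j, z)))]; rewrite /= /apply_step /= E eqxx.
by exists [:: (x, y, (false, (j, z)))]; rewrite /= /apply_step /= E eqxx.
Qed.

Lemma derives_trans u v w : derives u v -> derives v w -> derives u w.
Proof. by move=> [l <-] [m <-]; exists (l ++ m); rewrite foldl_cat. Qed.

Lemma apply_stepP u e : exists x y p q,
  [/\ u = x ++ p ++ y, apply_step u e = x ++ q ++ y &
   p = q \/ exists j z, (p, q) = rule j z \/ (q, p) = rule j z].
Proof.
case: e => -[x y] [d [j z]]; rewrite /apply_step /=.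
case: eqP => [->|_]; last first.
  by exists [::], [::], u, u; rewrite /= cats0; split => //; left.
exists x, y; case: d.
  exists (rule j z).1, (rule j z).2; split=> //; right.
  by exists j, z; rewrite -surjective_pairing; left.
exists (rule j z).2, (rule j z).1; split=> //; right.
by exists j, z; rewrite -surjective_pairing; right.
Qed.

Lemma derives_congruence : congruence derives.
Proof.
split.
- by move=> u; exists [::].
- move=> u v [l]; elim: l u => [|e l IH] u /=; first by move<-; exists [::].
  move/IH=> /derives_trans; apply.
  have [x [y [p [q [uE -> pq]]]]] := apply_stepP u e; rewrite uE.
  case: pq => [->|[j [z pq]]]; first by exists [::].
  by apply: derives_step; exists j, z; case: pq; [right|left].
- exact: derives_trans.
- move=> x y u v [l]; elim: l u => [|e l IH] u /=; first by move->; exists [::].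
  move/IH; apply: derives_trans.
  have [x' [y' [p [q [uE -> jz]]]]] := apply_stepP u e; rewrite uE.
  case: jz => [->|jz]; first by exists [::].
  by have := derives_step (x ++ x') (y' ++ y) jz; rewrite !catA.
Qed.

Lemma derivesP u v : pres_congr S u v <-> derives u v.
Proof.
have base p q : (exists j z, (p, q) = rule j z \/ (q, p) = rule j z) -> derives p q.
  by move/(derives_step [::] [::]); rewrite !cats0.
split; last first.
  move=> [l <-] {v}; elim: l u => [|e l IH] u /=; first exact: congr_refl.
  exact: congr_trans (apply_step_sound _ _) (IH _).
apply: pres_congr_min => {u v} [|w|u v|u v uv]; first exact: derives_congruence.
- by apply: base; exists ord0, (w, w); left.
- by apply: base; exists (lift ord0 ord0), (u, v); left.
- apply: base.
  have ui : (index (u, v) rs).+2 < (size rs).+2 by rewrite !ltnS index_mem.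
  by exists (Ordinal ui), ([::], [::]); left; rewrite /rule /= nth_index.
Qed.

Lemma semidecidable_pres_congr :
  semidecidable (fun z : W * W => pres_congr S z.1 z.2).
Proof.
have sd : semidecidable (fun z : W * W => exists l, foldl apply_step z.1 l == z.2).
  apply: semidecidable_ex.
    have eW : enumerable W by apply: enumerable_seq (enumerable_fin _).
    apply: enumerable_seq; apply: enumerable_pair (enumerable_pair eW eW) _.
    apply: enumerable_pair (enumerable_fin _) _.
    exact: enumerable_pair (enumerable_fin _) (enumerable_pair eW eW).
  apply: semidecidable_computable; computability.
  apply: (computable_foldl (f := fun _ u e => apply_step u e)); computability.
  by apply: computable_apply_step; computability.
apply: semidecidable_iff sd _ => z; rewrite derivesP.
by split=> [[l /eqP]|[l <-]]; exists l.
Qed.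

End Derivations.

(** * Finite inverse automata *)

Section Run.
Variables (B : Type) (X : Type) (delta : X -> B * bool -> option X).

Definition advance (o : option X) (l : B * bool) : option X := obind (delta^~ l) o.
Definition run (o : option X) (w : word B) : option X := foldl advance o w.

Lemma run_none w : run None w = None.
Proof. by elim: w. Qed.

Lemma run_cat o u v : run o (u ++ v) = run (run o u) v.
Proof. exact: foldl_cat. Qed.

Definition reversible := forall p l q,
  delta p l = Some q -> delta q (letter_inv l) = Some p.

Hypothesis delta_rev : reversible.

Lemma run_inv p w q : run (Some p) w = Some q -> run (Some q) (word_inv w) = Some p.
Proof.
elim: w p => [|l w IH] p /=; first by move=> [->].
case E : (delta p l) => [r|]; last by rewrite run_none.
by move/IH; rewrite word_inv_cons run_cat => ->; rewrite /= (delta_rev E).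
Qed.

(** In a reversible automaton $ww^{-1}$ acts as the identity restricted to the domain of $w$. Such
    restrictions commute, whence the Wagner relations. *)
Lemma run_idem p w : run (Some p) (w ++ word_inv w) =
  if run (Some p) w is Some _ then Some p else None.
Proof.
rewrite run_cat; case E : (run _ w) => [q|]; last by rewrite run_none.
exact: run_inv.
Qed.

(** The renaming [g] is there to let words over $A\setminus\{a_i\}$ be read by an automaton over
    $A$. Every transition ends in [Q], so runs from [Q] stay in it and the relations matter at those
    states only. *)
Lemma run_congr (C : choiceType) (g : C -> B) (Q : X -> Prop)
    (S : set (word C * word C)) :
  (forall p l q, delta p l = Some q -> Q q) ->
  (forall p, Q p -> forall u v, S (u, v) ->
     run (Some p) [seq (g l.1, l.2) | l <- u] =
     run (Some p) [seq (g l.1, l.2) | l <- v]) ->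
  forall u v, pres_congr S u v -> forall p, Q p ->
     run (Some p) [seq (g l.1, l.2) | l <- u] =
     run (Some p) [seq (g l.1, l.2) | l <- v].
Proof.
move=> Qd QS.
have Qrun p w q : Q p -> run (Some p) w = Some q -> Q q.
  elim: w p => [|l w IH] p Qp /=; first by move=> [<-].
  case E : (delta p l) => [r|]; last by rewrite run_none.
  exact: IH (Qd _ _ _ E).
have map_inv w : [seq (g l.1, l.2) | l <- word_inv w] =
    word_inv [seq (g l.1, l.2) | l <- w].
  by elim: w => // l w IH; rewrite word_inv_cons map_cat IH [in RHS]/= word_inv_cons.
apply: pres_congr_min => [|w p _|u v p _|u v uv p Qp]; last exact: QS.
- split=> [//|u v uv p /uv -> //|u v w uv vw p Qp|x y u v uv p Qp].
    by rewrite uv ?vw.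
  rewrite !map_cat !run_cat; case E : (run (Some p) _) => [q|];
    last by rewrite !run_none.
  by rewrite uv //; exact: Qrun E.
- rewrite !map_cat map_inv catA run_cat run_idem.
  by case E : (run (Some p) [seq (g l.1, l.2) | l <- w]) => [q|]; rewrite ?run_none.
- rewrite !map_cat !map_inv; move: [seq _ | l <- u] [seq _ | l <- v] => a b.
  rewrite (catA a) (catA b) !(run_cat _ (_ ++ word_inv _)) !run_idem.
  case Ea : (run (Some p) a) => [q|]; case Eb : (run (Some p) b) => [r|];
    by rewrite ?run_none ?run_idem ?Ea ?Eb.
Qed.

End Run.

(** * Automata given by finite tables *)

Section TableAutomaton.
Variables (A : finType) (T : countType).

Let state : countType := (A * T)%type.
Let letter : countType := (A * bool)%type.

(** The first component of a state is the index $i$ of the monoid $M_i$ it belongs to. The list of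
    states also fixes the order of the entries of state vectors. *)
Definition automaton : countType := (seq state * seq (state * letter * state))%type.

Definition lookup (E : seq (state * letter * state)) (p : state) (l : letter) :
    option state :=
  ohead [seq e.2 | e <- E & e.1 == (p, l)].

(* Transitions of the table that are not undone by the table are dropped, which
   makes every table reversible. *)
Definition delta (c : automaton) (p : state) (l : letter) : option state :=
  if lookup c.2 p l is Some q then
    if [&& p \in c.1, q \in c.1, p.1 == q.1 & lookup c.2 q (letter_inv l) == Some p]
    then Some q else None
  else None.

Lemma delta_reversible c : reversible (delta c).
Proof.
rewrite /reversible /delta => p l q; case E : (lookup _ p l) => [r|] //.
case: ifP => // /and4P[pc rc pr /eqP E'] [<-].
by rewrite E' letter_invK E eqxx eq_sym pr pc rc.
Qed.

Lemma delta_mem c p l q : delta c p l = Some q -> q \in c.1 /\ p.1 = q.1.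
Proof.
rewrite /delta; case: (lookup _ p l) => [r|] //.
by case: ifP => // /and4P[_ rc /eqP pr _] [<-].
Qed.

(** The erased letter has to loop at each state of its index; its inverse then loops too, by
    reversibility. Relations can thus be tested unerased. *)
Definition respects (rs : seq (word A * word A)) (c : automaton) : bool :=
  all (fun p : state => (run (delta c) (Some p) [:: (p.1, false)] == Some p) &&
    all (fun r => run (delta c) (Some p) r.1 == run (delta c) (Some p) r.2) rs) c.1.

Lemma respects_erase rs c p w : respects rs c -> p \in c.1 ->
  run (delta c) (Some p) w =
  run (delta c) (Some p) [seq (val l.1, l.2) | l <- erase p.1 w].
Proof.
move=> /allP cr; elim: w p => //= l w IH p pc.
have [pl _] := andP (cr _ pc).
have loop b : delta c p (p.1, b) = Some p.
  by case: b; [apply: (delta_reversible (l := (p.1, false)))|]; move/eqP: pl.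
case: insubP => [x _ xl|]; last first.
  by rewrite negbK => /eqP lp; case: l lp => a b /= ->; rewrite loop IH.
rewrite /= xl -surjective_pairing; case E : (delta c p l) => [q|];
  last by rewrite !run_none.
by have [qc ->] := delta_mem E; exact: IH.
Qed.

Lemma respects_congr rs (R : set (word A * word A)) c i u v :
  R = [set` rs] -> respects rs c ->
  pres_congr (@erase_rels A R i) (erase i u) (erase i v) ->
  forall p, p \in c.1 -> p.1 = i ->
    run (delta c) (Some p) u = run (delta c) (Some p) v.
Proof.
move=> RE cr uv p pc pi; rewrite (respects_erase _ cr pc) (respects_erase v cr pc) pi.
pose Q p := p \in c.1 /\ p.1 = i.
(* [run_congr] wants every transition to end in [Q], including those from states of other indices.
   Cutting [delta] down to index [i] ensures this and changes no run from a state of index [i], as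
   transitions preserve the index. *)
pose d p l := if p.1 == i then delta c p l else None.
have d_run q w : q.1 = i -> run d (Some q) w = run (delta c) (Some q) w.
  elim: w q => //= l w IH q qi; rewrite /d qi eqxx.
  case E : (delta c q l) => [r|]; last by rewrite !run_none.
  by apply: IH; have [_ <-] := delta_mem E.
have d_rev : reversible d.
  move=> q l r; rewrite /d; case: eqP => // qi E.
  by have [_ <-] := delta_mem E; rewrite qi eqxx (delta_reversible E).
rewrite -!d_run //; apply: (run_congr d_rev (Q := Q) _ _ uv) => // [q l r|q [qc qi]].
  by rewrite /d; case: eqP => // qi /delta_mem[rc qr]; split=> //; rewrite -qr.
move=> _ _ [[u' v'] /= Ruv [<- <-]]; rewrite !d_run // -qi -!(respects_erase _ cr qc).
have /andP[_ /allP rel] := allP cr _ qc.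
by move: Ruv; rewrite RE => /rel/eqP.
Qed.

Definition closed_vectors (c : automaton) (C : seq (seq (option state))) : bool :=
  ([seq Some p | p <- c.1] \in C) &&
  all (fun x => all (fun l => [seq advance (delta c) o l | o <- x] \in C)
                    (enum {: A * bool})) C.

Lemma closed_vectors_run c C v : closed_vectors c C ->
  [seq run (delta c) (Some p) v | p <- c.1] \in C.
Proof.
move=> /andP[C0 /allP Cs]; elim/last_ind: v => [//|v l IH].
have : l \in enum {: A * bool} by rewrite mem_enum.
move/(allP (Cs _ IH)).
rewrite -map_comp; congr (_ \in C); apply: eq_map => p /=.
by rewrite -cats1 run_cat.
Qed.

(** [W i] represents the component $g_i$; the words for distinct [i] need not be related, so each
    state runs the word of its own index. *)
Definition separates (rs : seq (word A * word A)) (W : A -> word A)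
    (z : automaton * seq (seq (option state))) : bool :=
  [&& respects rs z.1, closed_vectors z.1 z.2 &
      [seq run (delta z.1) (Some p) (W p.1) | p <- z.1.1] \notin z.2].

Lemma separates_sound rs (R : set (word A * word A)) W z :
  R = [set` rs] -> separates rs W z ->
  ~ exists v, forall i, pres_congr (@erase_rels A R i) (erase i v) (erase i (W i)).
Proof.
move=> RE /and3P[cr /closed_vectors_run zc /negP zW] [v vW]; apply: zW.
suff <- : [seq run (delta z.1) (Some p) v | p <- z.1.1] =
    [seq run (delta z.1) (Some p) (W p.1) | p <- z.1.1] by exact: zc.
apply/eq_in_map => p pc.
exact: (respects_congr RE cr (vW p.1) pc erefl).
Qed.

End TableAutomaton.

(** * Separation by a finite automaton *)

Section WagnerMorphism.
Variables (B : Type) (M : monoidType) (h : word B -> M).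

Definition wagner_morphism : Prop :=
  [/\ h [::] = 1%g, forall u v, h (u ++ v) = (h u * h v)%g,
      forall w, h (w ++ word_inv w ++ w) = h w &
      forall u v, h (u ++ word_inv u ++ v ++ word_inv v) =
                  h (v ++ word_inv v ++ u ++ word_inv u)].

Hypothesis hW : wagner_morphism.

(* Locked, since rewriting with [mulgA] would otherwise unfold it. *)
Definition idem (w : word B) : M := locked (h w * h (word_inv w))%g.

Lemma idemE w : idem w = (h w * h (word_inv w))%g.
Proof. by rewrite /idem -lock. Qed.

Lemma wm_nil : h [::] = 1%g. Proof. by case: hW. Qed.
Lemma wm_cat u v : h (u ++ v) = (h u * h v)%g. Proof. by case: hW. Qed.

Lemma idem_mul w : (idem w * h w)%g = h w.
Proof. by rewrite idemE -mulgA -!wm_cat; case: hW. Qed.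

Lemma idem_inv_mul w : (h w * idem (word_inv w))%g = h w.
Proof. by rewrite idemE word_invK mulgA -idemE idem_mul. Qed.

Lemma idemC u v : (idem u * idem v)%g = (idem v * idem u)%g.
Proof. by rewrite !idemE -!mulgA -!wm_cat; case: hW. Qed.

Lemma idem_idem w : (idem w * idem w)%g = idem w.
Proof. by rewrite [in LHS](idemE w) mulgA -idemE idem_mul -idemE. Qed.

Lemma idem_cat u v : idem (u ++ v) = (h u * idem v * h (word_inv u))%g.
Proof. by rewrite !idemE word_inv_cat !wm_cat !mulgA. Qed.

(** Inverses are taken on words, so equal values do not at once give equal inverses. But each of the
    two idempotents absorbs the other, and they commute. *)
Lemma idem_eq u v : h u = h v -> idem u = idem v.
Proof.
move=> uv; have uvE : (idem u * idem v)%g = idem v.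
  by rewrite (idemE v) mulgA -uv idem_mul.
have vuE : (idem v * idem u)%g = idem u.
  by rewrite (idemE u) mulgA uv idem_mul.
by rewrite -uvE idemC vuE.
Qed.

(* The partial action of [w] by right multiplication is defined at [x] when
   [x w w^-1 = x]; this is the domain of a composite of two such actions. *)
Lemma idem_fix_cat (x : M) u v : (x * idem (u ++ v))%g = x <->
  (x * idem u)%g = x /\ (x * h u * idem v)%g = (x * h u)%g.
Proof.
rewrite idem_cat; split=> [xE|[xu xuv]]; last first.
  by rewrite !mulgA xuv -mulgA -idemE.
have hVE : (h (word_inv u) * idem u)%g = h (word_inv u).
  by rewrite -{2}[u]word_invK idem_inv_mul.
have xu : (x * idem u)%g = x by rewrite -{1}xE -[RHS]xE -!mulgA hVE.
split=> //.
(* Multiplying $x=x\,uvv^{-1}u^{-1}$ by $u$ gives $xu=xu\cdot vv^{-1}\cdot u^{-1}u$; as the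
   idempotents commute, $vv^{-1}$ fixes $xu$. *)
have xuE : (x * h u)%g = (x * h u * idem v * idem (word_inv u))%g.
  by rewrite -{1}xE (idemE (word_inv u)) word_invK !mulgA.
move: (x * h u)%g xuE => y yE.
by rewrite {1}yE -2!mulgA (idemC _ v) (mulgA (idem v)) idem_idem mulgA -yE.
Qed.

End WagnerMorphism.

Fixpoint lists_of (T : eqType) (s : seq T) (n : nat) : seq (seq T) :=
  if n is m.+1 then [seq a :: t | a <- s, t <- lists_of s m] else [:: [::]].

Lemma mem_lists_of (T : eqType) (s : seq T) t :
  {subset t <= s} -> t \in lists_of s (size t).
Proof.
elim: t => // a t IH ts /=; apply: allpairs_f; first by apply: ts; rewrite mem_head.
by apply: IH => b bt; apply: ts; rewrite in_cons bt orbT.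
Qed.

(** * The automaton of right multiplication on the factors of the components *)

Section SeparatingAutomaton.
Variables (A : finType) (M : A -> monoidType) (h : forall i, word A -> M i).
Variables (rep : forall i, M i -> word A) (rs : seq (word A * word A)).
Variable W : A -> word A.

Hypothesis hW : forall i, wagner_morphism (h i).
Hypothesis hK : forall i, cancel (@rep i) (h i).
Hypothesis h_erased : forall i b, h i [:: (i, b)] = 1%g.
Hypothesis h_rel : forall i r, r \in rs -> h i r.1 = h i r.2.
Hypothesis h_above : forall i, finite_J_above (M i).

Let T : countType := seq (A * bool).
Let state : countType := (A * T)%type.
Let letter : countType := (A * bool)%type.

Let val_of (p : state) : M p.1 := h p.1 p.2.
Let defined (p : state) (w : word A) : Prop :=
  (val_of p * idem (h p.1) w)%g = val_of p.
Let target (p : state) (w : word A) : state := (p.1, rep (val_of p * h p.1 w)%g).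
(** The first clause says that the stored word is the chosen representative of its value, so that
    states of index [i] correspond to elements of [M i]. *)
Let good (p : state) : Prop :=
  p = target p [::] /\ is_factor (val_of p) (h p.1 (W p.1)).

Let val_target p w : val_of (target p w) = (val_of p * h p.1 w)%g.
Proof. exact: hK. Qed.

Lemma factor_mull (N : monoidType) (x u y v : N) :
  is_factor (x * u * y)%g v -> is_factor u v.
Proof. by move=> [a [b ->]]; exists (a * x)%g, (y * b)%g; rewrite !mulgA. Qed.

(** If $x=xww^{-1}$ then $xw$ is a factor of $x$, hence of whatever $x$ is a factor of. *)
Let good_target p w : good p -> defined p w -> good (target p w).
Proof.
move=> [_ pf] pw; split.
  by rewrite {2}/target val_target /= (wm_nil (hW _)) mulg1.
rewrite val_target /=; apply: (@factor_mull _ 1%g _ (h p.1 (word_inv w))).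
by rewrite mul1g -mulgA -idemE pw.
Qed.

Let good_finite : exists Q : seq state, forall p, p \in Q <-> good p.
Proof.
have sP i : exists s : seq (M i), forall u, u \in s <-> is_factor u (h i (W i)).
  have /finite_seqP[s sE] := h_above (h i (W i)).
  by exists s => u; rewrite -[is_factor u _]/([set u | is_factor u (h i (W i))] u) sE.
pose s i := projT1 (cid (sP i)); have sE i := projT2 (cid (sP i)).
exists (flatten [seq [seq (i, rep x) | x <- s i] | i <- enum A]) => p; split.
  move=> /flatten_mapP[i _ /mapP[x xs ->]]; rewrite /good /target /val_of /= hK.
  by rewrite (wm_nil (hW _)) mulg1; split=> //; apply/sE.
move=> [pE pf]; apply/flatten_mapP; exists p.1; first by rewrite mem_enum.
rewrite pE /target (wm_nil (hW _)) mulg1; apply: map_f; exact/sE.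
Qed.

Section Build.
Variable Q : seq state.
Hypothesis Qgood : forall p, p \in Q <-> good p.

Let E : seq (state * letter * state) :=
  [seq ((e.1, e.2), target e.1 [:: e.2]) |
     e <- [seq e : state * letter <-
               [seq (p, l) | p <- Q, l <- enum {: A * bool}] |
             `[< defined e.1 [:: e.2] >] ] ].

Let lookupE p l : lookup E p l =
  if (p \in Q) && `[< defined p [:: l] >] then Some (target p [:: l]) else None.
Proof.
rewrite /lookup; set s := [seq _ <- E | _].
have sP e : e \in s -> e = ((p, l), target p [:: l]) /\ p \in Q /\ defined p [:: l].
  rewrite mem_filter => /andP[/eqP el /mapP[[p' l']]].
  rewrite mem_filter => /andP[/asboolP /= d /allpairsP[[p1 l1] /= [pQ _ [pp ll]]]].
  by subst p1 l1 => eE; move: el; rewrite eE => -[? ?]; subst p' l'.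
case: ifP => [/andP[pQ /asboolP d]|np].
  have : ((p, l), target p [:: l]) \in s.
    rewrite mem_filter eqxx; apply/mapP; exists (p, l) => //.
    rewrite mem_filter asboolT //=; apply: allpairs_f => //.
    by rewrite mem_enum.
  by case: (s) sP => // e s' sP _ /=; have [-> _] := sP e (mem_head _ _).
case: (s) sP => // e s' /(_ e (mem_head _ _))[_ [pQ d]].
by rewrite pQ asboolT in np.
Qed.

Let c : automaton A T := (Q, E).

(** The reversibility test inside [delta] removes nothing here: if $x\ell\ell^{-1}=x$, then
    $\ell^{-1}$ is defined at $x\ell$ and leads back to $x$. *)
Let deltaE p l : p \in Q -> delta c p l =
  if `[< defined p [:: l] >] then Some (target p [:: l]) else None.
Proof.
move=> pQ; rewrite /delta [c.2]/= [c.1]/= lookupE pQ /=.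
case: asboolP => // d; have tQ : target p [:: l] \in Q.
  by apply/Qgood; apply: good_target => //; apply/Qgood.
have [pE _] := (Qgood p).1 pQ.
have lE : letter_inv l :: [::] = word_inv [:: l] by [].
rewrite tQ eqxx lookupE tQ /= asboolT /=; last first.
  rewrite /defined val_target /= lE -mulgA.
  by rewrite (idem_inv_mul (hW _)).
rewrite /target -/(target p [:: l]) val_target /= lE -mulgA -idemE d.
by rewrite [in X in _ == X]pE /target (wm_nil (hW _)) mulg1 eqxx.
Qed.

Let runE p w : p \in Q -> run (delta c) (Some p) w =
  if `[< defined p w >] then Some (target p w) else None.
Proof.
elim: w p => [|l w IH] p pQ.
  have [pE _] := (Qgood p).1 pQ.
  rewrite asboolT -?pE // /defined idemE /= (wm_nil (hW _)) !mulg1 //.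
rewrite /= deltaE //; case: asboolP => [d|nd]; last first.
  rewrite run_none asboolF // => /(idem_fix_cat (hW _) (val_of p) [:: l] w)[].
  by move/nd.
have tQ : target p [:: l] \in Q.
  by apply/Qgood; apply: good_target => //; apply/Qgood.
rewrite IH //.
have -> : defined (target p [:: l]) w = defined p (l :: w).
  rewrite propeqE /defined -(cat1s l w) (idem_fix_cat (hW _) (val_of p)).
  by rewrite val_target; split=> [|[]].
by rewrite /target -/(target p [:: l]) val_target -mulgA -(wm_cat (hW _)).
Qed.

Let respects_c : respects rs c.
Proof.
apply/allP => p pQ; apply/andP; split.
  have [pE _] := (Qgood p).1 pQ.
  rewrite runE // asboolT /target ?h_erased; last first.
    by rewrite /defined idemE h_erased (h_erased p.1 true) !mulg1.
  by rewrite [in X in _ == X]pE /target (wm_nil (hW _)).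
apply/allP => r rrs; rewrite !runE //.
(* Equal values have equal targets and, by [idem_eq], equal domains. *)
have uv := h_rel p.1 rrs.
by rewrite /defined /target (idem_eq (hW _) uv) uv.
Qed.

Let vec v := [seq run (delta c) (Some p) v | p <- Q].
(** All vectors over the states form a finite list, and the filter keeps those reached by some word.
    The set is thus closed under the letters, and missing a vector means that no word reaches it. *)
Let C := [seq x <- lists_of (None :: [seq Some p | p <- Q]) (size Q) |
           `[< exists v, x = vec v >] ].

Let vecC v : vec v \in C.
Proof.
rewrite mem_filter asboolT /=; last by exists v.
rewrite -(size_map (fun p => run (delta c) (Some p) v) Q).
apply: mem_lists_of => o /mapP[p pQ ->].
rewrite runE //; case: asboolP => d; last by rewrite mem_head.
rewrite in_cons; apply/orP; right; apply: map_f; apply/Qgood.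
by apply: good_target => //; apply/Qgood.
Qed.

Let closed_C : closed_vectors c C.
Proof.
apply/andP; split; first exact: vecC [::].
apply/allP => x; rewrite mem_filter => /andP[/asboolP[v ->] _].
apply/allP => l _; rewrite -map_comp.
rewrite (_ : map _ _ = vec (v ++ [:: l])) //.
by apply: eq_map => p; rewrite run_cat.
Qed.

(** Only two states are used, $ww^{-1}$ and $vv^{-1}$. They give $w=ww^{-1}v$ and $v=vv^{-1}w$, and
    commuting idempotents yield $v=w$. *)
Let vec_inj v : vec v = [seq run (delta c) (Some p) (W p.1) | p <- Q] ->
  forall i, h i v = h i (W i).
Proof.
move=> /eq_in_map vW i; set w := W i.
have same u : is_factor (idem (h i) u) (h i w) ->
    (idem (h i) u * idem (h i) v)%g = idem (h i) u \/
    (idem (h i) u * idem (h i) w)%g = idem (h i) u ->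
    (idem (h i) u * h i v)%g = (idem (h i) u * h i w)%g.
  move=> uw d; pose p : state := (i, rep (idem (h i) u)).
  have pE : val_of p = idem (h i) u by exact: hK.
  have pQ : p \in Q.
    apply/Qgood; split; last by rewrite pE.
    by rewrite /target pE /= (wm_nil (hW i)) mulg1.
  have := vW p pQ; rewrite !runE // /defined pE /target pE /= -/w.
  case: asboolP => dv; case: asboolP => dw //; last by case: d.
  by move=> [] /(congr1 (h i)); rewrite !hK.
have hwE : (idem (h i) w * h i v)%g = h i w.
  rewrite same ?(idem_mul (hW i)) //; last by right; exact: idem_idem.
  by exists 1%g, (h i w); rewrite mul1g idem_mul.
(* That $vv^{-1}$ is a state at all comes from the previous equality: $w=ww^{-1}\cdot vv^{-1}\cdot
   v$ exhibits it as a factor of $w$. *)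
have hvE : h i v = (idem (h i) v * h i w)%g.
  rewrite -same ?(idem_mul (hW i)) //; last by left; exact: idem_idem.
  by exists (idem (h i) w), (h i v); rewrite -mulgA (idem_mul (hW i)).
by rewrite -[RHS]hwE [in RHS]hvE mulgA (idemC (hW i)) -mulgA (idem_mul (hW i)).
Qed.

Lemma separates_build : ~ (exists v, forall i, h i v = h i (W i)) ->
  exists z, separates rs W (z : automaton A T * seq (seq (option state))).
Proof.
move=> nv; exists (c, C); apply/and3P; split=> //.
rewrite mem_filter negb_and; apply/orP; left; apply/asboolPn => -[v vW].
by apply: nv; exists v; apply: vec_inj.
Qed.

End Build.

Lemma separates_complete : ~ (exists v, forall i, h i v = h i (W i)) ->
  exists z, separates rs W (z : automaton A T * seq (seq (option state))).
Proof. by have [Q Qgood] := good_finite; exact: separates_build Qgood. Qed.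

End SeparatingAutomaton.

(** * Munn trees *)

Section InvMonoid.
Variables (B : choiceType) (S : set (word B * word B)).

Definition inv_class (w : word B) : inv_monoid S := \pi_(inv_monoid S) w.

Lemma inv_class_eq u v : inv_class u = inv_class v <-> pres_congr S u v.
Proof. exact: inv_monoid_eqP. Qed.

Lemma wagner_inv_class : wagner_morphism inv_class.
Proof.
split=> [//|u v|w|u v].
- by rewrite -[(_ * _)%g]/(inv_mul _ _) inv_mul_pi.
- apply/inv_class_eq; apply: congr_base; left; apply: congr_base.
  by left; exists w.
- apply/inv_class_eq; apply: congr_base; left; apply: congr_base.
  by right; exists u, v.
Qed.

Lemma repr_inv_class (x : inv_monoid S) : inv_class (repr x) = x.
Proof. exact: reprK. Qed.

End InvMonoid.

(** * Reduced words and the Cayley graph of the free group *)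

Section Stacks.
Variable B : finType.
Let stack := word B.

(* A reduced word is stored with its last letter first. *)
Definition push (s : stack) (l : B * bool) : stack :=
  if s is l' :: s' then if l' == letter_inv l then s' else l :: s else [:: l].

Definition reduced (s : stack) : bool := sorted (fun a b => b != letter_inv a) s.

Lemma reduced_push s l : reduced s -> reduced (push s l).
Proof.
case: s => //= a s; case: eqP => [_|/eqP al]; first exact: path_sorted.
by rewrite /reduced /= al.
Qed.

Lemma pushK s l : reduced s -> push (push s l) (letter_inv l) = s.
Proof.
case: s => [|a s] /=; first by rewrite letter_invK eqxx.
case: eqP => [->|_ _]; last by rewrite /= letter_invK eqxx.
by case: s => //= b s /andP[/negbTE->].
Qed.

Lemma size_push s l : size (push s l) <= (size s).+1 /\ size s <= (size (push s l)).+1.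
Proof.
case: s => //= a s; case: eqP => _ /=; split=> //; first by rewrite ltnW.
by rewrite ltnW.
Qed.

(** For empty [s] these are the vertices of the Munn tree of [w]. *)
Definition trace (s : stack) (w : word B) : seq stack := s :: scanl push s w.

Lemma trace_rcons s w l :
  trace s (rcons w l) = rcons (trace s w) (push (foldl push s w) l).
Proof. by rewrite /trace -cats1 scanl_cat -cats1. Qed.

Lemma size_trace s w t : t \in trace s w ->
  size t <= size s + size w /\ size s <= size t + size w.
Proof.
elim: w s => [|l w IH] s; first by rewrite inE => /eqP->; rewrite addn0.
rewrite in_cons => /orP[/eqP->|]; first by rewrite leq_addr.
move/(IH (push s l)) => [h1 h2]; have [h3 h4] := size_push s l.
split; first by rewrite (leq_trans h1) //= addnS -addSn leq_add2r.
by rewrite (leq_trans h4) //= addnS ltnS.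
Qed.

(** The Cayley graph of the free group restricted to the vertices in [P]. A word runs from a reduced
    vertex exactly when its trace stays in [P], so the trace becomes visible to a reversible
    automaton. *)
Definition partial_push (P : pred stack) (s : stack) (l : B * bool) : option stack :=
  if [&& reduced s, P s & P (push s l)] then Some (push s l) else None.

Lemma partial_push_reversible P : reversible (partial_push P).
Proof.
rewrite /reversible /partial_push => s l t; case: ifP => // /and3P[rs Ps Pt] [<-].
by rewrite reduced_push // Pt pushK // Ps.
Qed.

Lemma run_partial_push (P : pred stack) s w : reduced s -> all P (trace s w) ->
  run (partial_push P) (Some s) w = Some (foldl push s w).
Proof.
elim: w s => //= l w IH s rs /and3P[Ps Pp Pw].
by rewrite {2}/partial_push rs Ps Pp /= IH ?reduced_push //= Pp.
Qed.

Lemma run_partial_push_inv (P : pred stack) s w t :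
  P s -> run (partial_push P) (Some s) w = Some t ->
  all P (trace s w) /\ t = foldl push s w.
Proof.
elim: w s => [|l w IH] s /= Ps; first by move=> [<-]; rewrite Ps.
rewrite {2}/partial_push; case: ifP => [/and3P[rs _ Pp]|]; last by rewrite run_none.
by case/(IH _ Pp) => /andP[_ Pw] ->; rewrite Ps Pp.
Qed.

Lemma run_partial_push_congr P u v s :
  pres_congr set0 u v ->
  run (partial_push P) (Some s) u = run (partial_push P) (Some s) v.
Proof.
move=> uv; have map_id' w : [seq (id l.1, l.2) | l <- w] = w :> word B.
  by rewrite -[RHS]map_id; apply: eq_map => -[].
rewrite -(map_id' u) -(map_id' v).
exact: (@run_congr _ _ (partial_push P) (@partial_push_reversible P) _ id (fun=> True) set0).
Qed.

(** Start at the reduced form [s0] of $x^{-1}$ and let [P] be the vertices visited by $v$ from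
    there. As $v$ runs inside [P], so does the equivalent $xuy$. After $x$ it is at the empty word,
    so [P] contains that word and the trace of $u$. The former bounds the length of [s0] by $|v|$,
    and vertices of [P] are at most $|v|$ longer than [s0]. *)
Lemma trace_factor x u y v : pres_congr set0 v (x ++ u ++ y) ->
  forall t, t \in trace [::] u -> size t <= (size v).*2.
Proof.
move=> vE; pose s0 := foldl push [::] (word_inv x).
have s0x : foldl push s0 x = [::].
  have := run_partial_push (P := predT) (w := word_inv x) (s := [::]) isT.
  rewrite all_predT => /(_ isT) /(run_inv (@partial_push_reversible _)).
  by rewrite word_invK => /run_partial_push_inv[].
have red0 : reduced s0.
  rewrite /s0; elim/last_ind: (word_inv x) => // w l IH.
  by rewrite -cats1 foldl_cat /=; exact: reduced_push.
pose P := mem (trace s0 v).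
have := run_partial_push (P := P) (w := v) red0; rewrite (introT allP) // => /(_ isT).
rewrite (run_partial_push_congr _ _ vE) !run_cat.
case Ex : (run _ _ x) => [r|]; last by rewrite !run_none.
have [/allP Px rE] := run_partial_push_inv (mem_head _ _) Ex.
rewrite rE s0x in Ex *.
have P0 : P [::].
  rewrite -s0x; apply: Px; rewrite /trace.
  by elim/last_ind: (x) => [|w l _]; rewrite ?mem_head // -/(trace _ _) trace_rcons
    mem_rcons -cats1 foldl_cat mem_head.
case Eu : (run _ _ u) => [r'|]; last by rewrite !run_none.
have [/allP Pu _] := run_partial_push_inv P0 Eu => _ t /Pu /size_trace[+ _].
have [_] := size_trace P0; rewrite add0n => s0v /leq_trans; apply.
by rewrite -addnn leq_add2r.
Qed.

End Stacks.

(** * Munn normal forms in the free inverse monoid *)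

Section FreeInverse.
Variable B : finType.
Let M := inv_monoid (set0 : set (word B * word B)).
Let h : word B -> M := @inv_class B set0.
Let hW : wagner_morphism h := wagner_inv_class _.

Definition idem_prod (T : seq (word B)) : M := (\prod_(t <- T) idem h (rev t))%g.

Lemma idem_prodC t T : (idem h t * idem_prod T = idem_prod T * idem h t)%g.
Proof.
rewrite /idem_prod; elim: T => [|s T IH]; first by rewrite big_nil mulg1 mul1g.
by rewrite big_cons mulgA (idemC hW) -mulgA IH mulgA.
Qed.

Lemma idem_prod_mem t T : t \in T -> (idem_prod T * idem h (rev t) = idem_prod T)%g.
Proof.
rewrite -idem_prodC /idem_prod; elim: T => // s T IH; rewrite in_cons big_cons.
case/orP=> [/eqP->|/IH tT]; first by rewrite mulgA (idem_idem hW).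
by rewrite mulgA (idemC hW) -mulgA tT.
Qed.

Lemma idem_prod_sub T T' :
  {subset T <= T'} -> (idem_prod T' * idem_prod T = idem_prod T')%g.
Proof.
elim: T => [|t T IH] TT'; first by rewrite /idem_prod big_nil mulg1.
rewrite {2}/idem_prod big_cons mulgA idem_prod_mem ?TT' ?mem_head //.
by apply: IH => s sT; apply: TT'; rewrite in_cons sT orbT.
Qed.

Lemma idem_prod_eq T T' : T =i T' -> idem_prod T = idem_prod T'.
Proof.
move=> TT'; rewrite -(@idem_prod_sub T' T) => [|t]; last by rewrite TT'.
rewrite -[RHS](@idem_prod_sub T T') => [|t]; last by rewrite TT'.
elim: T {TT'} => [|t T IH]; first by rewrite /idem_prod !big_nil mulg1 mul1g.
by rewrite /idem_prod !big_cons -!/(idem_prod _) -mulgA IH !mulgA idem_prodC.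
Qed.

(** Appending a letter either extends the reduced word, adding a vertex and its idempotent, or
    cancels its last letter and returns to a shorter word. *)
Lemma munn_normal_form u : h u =
  (idem_prod (trace [::] u) * h (rev (foldl (@push B) [::] u)))%g.
Proof.
elim/last_ind: u => [|u l IH].
  by rewrite /idem_prod big_seq1 idemE /= !(wm_nil hW) !mulg1.
rewrite trace_rcons -!cats1 (wm_cat hW) IH foldl_cat.
set T := trace _ u; set r := foldl _ _ u; rewrite [foldl _ r _]/=.
have rT : r \in T.
  rewrite /T /r; elim/last_ind: (u) => // w a _.
  by rewrite trace_rcons mem_rcons -cats1 foldl_cat mem_head.
rewrite /idem_prod big_cat big_seq1 /= -/(idem_prod T) -mulgA -[RHS]mulgA (idem_mul hW).
case: {-2}r (erefl r) => [|a s] rE; first by rewrite (wm_nil hW) mul1g.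
rewrite /push; case: eqP => [al|_]; last by rewrite (rev_cons l) -cats1 (wm_cat hW).
have -> : l = letter_inv a by rewrite al letter_invK.
(* Cancellation leaves a factor $aa^{-1}$ behind the shortened word $s$. Moved in front of $s$ it
   becomes $(sa)(sa)^{-1}$, which the product absorbs because $sa$ is already a vertex. *)
have sE : (idem h (rev (a :: s)) * h (rev s) = h (rev s) * idem h [:: a])%g.
  rewrite rev_cons -cats1 (idem_cat hW) -mulgA -{3}[rev s]word_invK -idemE.
  by rewrite -mulgA (idemC hW) mulgA (idem_inv_mul hW).
rewrite -[in RHS](idem_prod_mem rT) -rE -[RHS]mulgA sE rev_cons -cats1 (wm_cat hW).
by rewrite -mulgA idemE.
Qed.

Lemma free_inverse_finite_J_above : finite_J_above M.
Proof.
move=> x; pose v := repr x.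
pose letters := enum {: B * bool}.
pose L := flatten [seq lists_of letters n | n <- iota 0 (size v).*2.+1].
have memL t : size t <= (size v).*2 -> t \in L.
  move=> tv; apply/flatten_mapP; exists (size t); first by rewrite mem_iota ltnS tv.
  by apply: mem_lists_of => a _; rewrite mem_enum.
(* The masks run through the subsets of [L]. That suffices for vertex sets, since [idem_prod]
   ignores order and repetition. *)
pose cand := [seq (idem_prod (mask m L) * h (rev r))%g |
  m <- lists_of [:: true; false] (size L), r <- L].
apply: (@sub_finite_set _ _ [set` cand]); last exact: finite_seq.
move=> u [a [b xE]]; rewrite /= (_ : u = h (repr u)); last by rewrite /h repr_inv_class.
have ok t : t \in trace [::] (repr u) -> t \in L.
  move=> tu; apply: memL; apply: (@trace_factor B (repr a) (repr u) (repr b)) tu.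
  apply/(@inv_class_eq B set0); rewrite !(wm_cat (wagner_inv_class _)) /v !repr_inv_class.
  by rewrite xE mulgA.
rewrite munn_normal_form (@idem_prod_eq _ (mask [seq t \in trace [::] (repr u) | t <- L] L)).
  apply: allpairs_f.
    rewrite -(size_map (fun t => t \in trace [::] (repr u))).
    by apply: mem_lists_of => -[].
  apply: ok; elim/last_ind: (repr u) => // w l _.
  by rewrite trace_rcons mem_rcons -cats1 foldl_cat mem_head.
move=> t; rewrite -filter_mask mem_filter.
by case: (boolP (t \in trace _ _)) => //= /ok ->.
Qed.

End FreeInverse.

(** * Certificates are checked computably *)

Section ComputableAutomata.
Variables (A : finType) (T : countType).
Let state : countType := (A * T)%type.
Let letter : countType := (A * bool)%type.
Let W : countType := seq letter.

Lemma computable_lookup (X : countType) (E : X -> seq (state * letter * state))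
    (p : X -> state) (l : X -> letter) : computable E -> computable p -> computable l ->
  computable (fun x => lookup (E x) (p x) (l x)).
Proof.
move=> cE cp cl; apply: computable_ohead; apply: computable_map; computability.
apply: (computable_filter (p := fun x e => e.1 == (p x, l x))) => //.
by computability; [apply: (computable_comp cp) | apply: (computable_comp cl)];
  computability.
Qed.

Lemma computable_letter_inv (X : countType) (l : X -> letter) :
  computable l -> computable (fun x => letter_inv (l x) : letter).
Proof. exact: computable_comp (computable_finfun _). Qed.

Lemma computable_delta (X : countType) (c : X -> automaton A T)
    (p : X -> state) (l : X -> letter) :
  computable c -> computable p -> computable l ->
  computable (fun x => delta (c x) (p x) (l x)).
Proof.
move=> cc cp cl; apply: computable_option_case; computability.
  by apply: computable_lookup; computability.
have cc' : computable (fun z : X * state => c z.1)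
  by apply: (computable_comp cc); computability.
have cp' : computable (fun z : X * state => p z.1)
  by apply: (computable_comp cp); computability.
have cl' : computable (fun z : X * state => l z.1)
  by apply: (computable_comp cl); computability.
apply: computable_and; first by apply: computable_mem; computability.
apply: computable_and; first by apply: computable_mem; computability.
apply: computable_and; computability.
by apply: computable_lookup; computability; exact: computable_letter_inv.
Qed.

Lemma computable_advance (X : countType) (c : X -> automaton A T) (o : X -> option state)
    (l : X -> letter) :
  computable c -> computable o -> computable l ->
  computable (fun x => advance (delta (c x)) (o x) (l x)).
Proof.
move=> cc co cl.
have cc' : computable (fun z : X * state => c z.1)
  by apply: (computable_comp cc); computability.
have cl' : computable (fun z : X * state => l z.1)
  by apply: (computable_comp cl); computability.
apply: computable_option_case; computability.
by apply: computable_delta; computability.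
Qed.

Lemma computable_run (X : countType) (c : X -> automaton A T) (o : X -> option state)
    (w : X -> W) :
  computable c -> computable o -> computable w ->
  computable (fun x => run (delta (c x)) (o x) (w x)).
Proof.
move=> cc co cw.
apply: (computable_foldl (f := fun x o l => advance (delta (c x)) o l)) => //.
apply: computable_advance; computability.
by apply: (computable_comp cc); computability.
Qed.

Lemma computable_respects (X : countType) rs (c : X -> automaton A T) :
  computable c -> computable (fun x => respects rs (c x)).
Proof.
move=> cc.
have cc1 : computable (fun z : X * state => c z.1)
  by apply: (computable_comp cc); computability.
have cc2 : computable (fun z : X * state * (W * W) => c z.1.1).
  by apply: (computable_comp cc); computability.
apply: (computable_all (p := fun x (p : state) =>
  (run (delta (c x)) (Some p) [:: (p.1, false)] == Some p) &&
  all (fun r => run (delta (c x)) (Some p) r.1 == run (delta (c x)) (Some p) r.2)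
      rs)); last by computability.
apply: computable_and; computability.
  by apply: computable_run; computability.
apply: (computable_all (p := fun z (r : W * W) =>
  run (delta (c z.1)) (Some z.2) r.1 == run (delta (c z.1)) (Some z.2) r.2));
  last by computability.
by computability; apply: computable_run; computability.
Qed.

Lemma computable_closed_vectors (X : countType) (c : X -> automaton A T)
    (C : X -> seq (seq (option state))) :
  computable c -> computable C -> computable (fun x => closed_vectors (c x) (C x)).
Proof.
move=> cc cC; apply: computable_and.
  apply: computable_mem => //; apply: computable_map; computability.
apply: (computable_all (p := fun x (y : seq (option state)) =>
  all (fun l => [seq advance (delta (c x)) o l | o <- y] \in C x)
      (enum {: A * bool}))) => //.
apply: (computable_all (p := fun z (l : letter) =>
  [seq advance (delta (c z.1)) o l | o <- z.2] \in C z.1)); last by computability.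
apply: computable_mem; last by apply: (computable_comp cC); computability.
apply: (computable_map (f := fun z o => advance (delta (c z.1.1)) o z.2));
  last by computability.
apply: computable_advance; computability.
by apply: (computable_comp cc); computability.
Qed.

Lemma computable_separates (X : countType) rs (w : A -> X -> W) :
  (forall i, computable (w i)) ->
  computable (fun z : X * (automaton A T * seq (seq (option state))) =>
    separates rs (w^~ z.1) z.2).
Proof.
move=> cw; apply: computable_and; first by apply: computable_respects; computability.
apply: computable_and; first by apply: computable_closed_vectors; computability.
apply: computable_bool_case; computability.
apply: computable_mem; computability.
apply: (computable_map (f := fun z p =>
  run (delta z.2.1) (Some p) (w p.1 z.1))); computability.
apply: computable_run; computability.
(* Which word to run depends on the index of the state, a finite case distinction. *)
apply: (computable_fin (f := fun z i => w i z.1.1)); computability.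
by move=> i; apply: (computable_comp (cw i)); computability.
Qed.

End ComputableAutomata.

(** * Decidability of the image *)

Section WordCodes.
Variable k : nat.
Let word_of (s : seq nat) : seq 'I_k :=
  flatten [seq [seq j <- enum 'I_k | val j == m] | m <- s].

Let word_ofK w : word_of [seq val j | j <- w] = w.
Proof.
rewrite /word_of -map_comp; elim: w => //= j w ->.
rewrite (eq_filter (a2 := pred1 j)) ?filter_pred1_uniq ?enum_uniq ?mem_enum //.
Qed.

(** Decoding drops entries that are not below [k]; a number is the code of a word exactly when
    nothing is dropped. The complement of the codes of [P] therefore also contains the invalid
    numbers. *)
Lemma semidecidable_word_codes (P : set (seq 'I_k)) :
  semidecidable P -> semidecidable (~` P) ->
  recursive_set [set word_code w | w in P].
Proof.
move=> sP sN; pose dec n := word_of (CodeSeq.decode n).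
have cdec : computable dec.
  have cD := computable_decode.
  apply: computable_flatten; apply: (computable_map (f := fun _ m =>
    [seq j <- enum 'I_k | val j == m])); computability.
  apply: computable_filter; computability.
  by apply: (computable_comp (computable_finfun (fun j : 'I_k => val j))); computability.
pose valid n := [seq val j | j <- dec n] == CodeSeq.decode n.
have cv : computable valid.
  have cD := computable_decode.
  rewrite /valid; computability; apply: (computable_map (f := fun _ (j : 'I_k) => val j)) => //.
  by apply: (computable_comp (computable_finfun (fun j : 'I_k => val j))); computability.
have DE n : [set word_code w | w in P] n <-> valid n /\ P (dec n).
  split=> [[w Pw <-]|[/eqP vn Pn]].
    by rewrite /valid /dec /word_code CodeSeq.codeK word_ofK.
  by exists (dec n) => //; rewrite /word_code vn CodeSeq.decodeK.
apply: recursive_set_semidecidable.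
  apply: semidecidable_iff (fun n => iff_sym (DE n)).
  apply: semidecidable_and (semidecidable_computable cv) _.
  exact: semidecidable_comp cdec sP.
apply: (semidecidable_iff (P := fun n => ~~ valid n \/ ~ P (dec n))).
  apply: semidecidable_or (semidecidable_comp cdec sN).
  by apply: semidecidable_computable; apply: computable_bool_case; computability.
move=> n; rewrite DE; split=> [[/negP nv [//]|nP [_ //]]|nD].
by case: (boolP (valid n)) => vn; [right=> Pn; apply: nD | left].
Qed.

End WordCodes.

Section Decidability.
Variables (A : finType) (R : set (word A * word A)).
Let M := erased_monoid R.

Definition erased_class (i : A) (v : word A) : M i :=
  inv_class (@erase_rels A R i) (erase i v).

(** Words over $A\setminus\{a_i\}$ are embedded in those over $A$, so that all components share one
    alphabet. *)
Definition erased_repr (i : A) (x : M i) : word A :=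
  [seq (val l.1, l.2) | l <- repr x].

Lemma wagner_erased_class i : wagner_morphism (erased_class i).
Proof.
have [h0 hD h1 h2] := wagner_inv_class (@erase_rels A R i).
rewrite /erased_class; split=> [//|u v|w|u v]; rewrite ?erase_cat ?erase_word_inv;
  [exact: hD | exact: h1 | exact: h2].
Qed.

Lemma erased_reprK i : cancel (@erased_repr i) (erased_class i).
Proof.
move=> x; rewrite /erased_class /erased_repr.
rewrite (_ : erase i _ = repr x); first exact: repr_inv_class.
by rewrite /erase map_pK // => -[a b] /=; rewrite valK.
Qed.

Lemma erased_class_letter i b : erased_class i [:: (i, b)] = 1%g.
Proof. by rewrite /erased_class /erase /= insubF ?eqxx. Qed.

Lemma range_epsP (x : prod_monoid M) : range (@eps A R) x <->
  exists v, forall i, erased_class i v = x i.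
Proof.
split=> [[y _ <-]|[v vx]].
  by exists (repr y) => i.
exists (\pi v) => //; apply: functional_extensionality_dep => i.
by rewrite -vx; exact: eraser_pi.
Qed.

Section Family.
Variables (k : nat) (g : 'I_k -> prod_monoid M).

Definition component (i : A) (w : seq 'I_k) : word A :=
  flatten [seq erased_repr (g j i) | j <- w].

(** Representatives come from choice, but for a fixed family [g] only finitely many occur, which
    makes them a finite table. *)
Lemma computable_component i : computable (component i : seq 'I_k -> seq (A * bool)).
Proof.
apply: computable_flatten.
apply: (computable_map (f := fun _ j => erased_repr (g j i) : seq (A * bool)));
  computability.
by apply: (computable_comp (computable_finfun (fun j =>
  erased_repr (g j i) : seq (A * bool)))); computability.
Qed.

Lemma eval_component i w : erased_class i (component i w) = eval_word g w i.
Proof.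
have hW := wagner_erased_class i.
rewrite /eval_word /component; elim: w => [|j w IH].
  by rewrite big_nil (wm_nil hW).
by rewrite big_cons /= (wm_cat hW) IH erased_reprK.
Qed.

End Family.

Lemma computable_erase (i : A) :
  computable (@erase A i : seq (A * bool) -> seq ({x : A | x != i} * bool)).
Proof.
have eE w : erase i w = flatten [seq erase i [:: l] | l <- w].
  elim: w => // l w IH; rewrite -cat1s erase_cat IH map_cat flatten_cat.
  by rewrite [flatten [seq _ | l <- [:: l]]]cats0.
apply: computable_ext (fun w => esym (eE w)); apply: computable_flatten.
apply: (computable_map (f := fun _ l =>
  erase i [:: l] : seq ({x : A | x != i} * bool))); computability.
by apply: (computable_comp (computable_finfun (fun l : A * bool =>
  erase i [:: l] : seq ({x : A | x != i} * bool)))); computability.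
Qed.

(** The generators have a letter in one component and 1 in the others; an element is the product,
    over the indices, of its components spelled out in such generators. *)
Lemma generated_prod_monoid : exists k (g : 'I_k -> prod_monoid M), generates g.
Proof.
pose I : finType := (A * (A * bool))%type.
pose e (t : I) : prod_monoid M :=
  fun i => if t.1 == i then erased_class i [:: t.2] else 1%g.
suff gen (x : prod_monoid M) : exists s : seq I, x = (\prod_(t <- s) e t)%g.
  exists #|I|, (fun j => e (enum_val j)) => x; have [s ->] := gen x.
  exists [seq enum_rank t | t <- s]; rewrite /eval_word big_map.
  by apply: eq_bigr => t _; rewrite enum_rankK.
exists (flatten [seq [seq (i, l) | l <- erased_repr (x i)] | i <- enum A]).
have prodE (s : seq I) i : (\prod_(t <- s) e t)%g i = (\prod_(t <- s) e t i)%g.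
  by elim: s => [|t s IH]; rewrite ?big_nil // !big_cons -IH.
apply: functional_extensionality_dep => i; rewrite prodE.
have hW := wagner_erased_class i.
have block j : (\prod_(t <- [seq (j, l) | l <- erased_repr (x j)]) e t i)%g =
    if j == i then x i else 1%g.
  rewrite big_map /e /=; case: eqP => [->|_]; last by rewrite big1_eq.
  rewrite -[RHS]erased_reprK; elim: (erased_repr _) => [|l w IH].
    by rewrite big_nil (wm_nil hW).
  by rewrite big_cons IH -(wm_cat hW).
(* As [enum A] has no repetitions, exactly one block contributes [x i] to the component [i], and the
   others contribute 1. *)
have : i \in enum A by rewrite mem_enum.
elim: (enum A) (enum_uniq A) => // j s IH /= /andP[js us].
rewrite big_cat block in_cons eq_sym; case: eqVneq => [ji _|_ /= /IH <- //];
  last by rewrite mul1g.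
rewrite [X in _ = (_ * X)%g](_ : _ = 1%g) ?mulg1 //.
subst j; elim: s {IH us} js => [|j s IH]; first by rewrite big_nil.
rewrite in_cons negb_or /= big_cat block => /andP[ij /IH ->].
by rewrite eq_sym (negbTE ij); exact: mulg1.
Qed.

Theorem decidable_range_eps : finite_set R ->
  (forall i, finite_J_above (M i)) -> decidable_membership (range (@eps A R)).
Proof.
move=> /finite_seqP[rs RE] above; split; first exact: generated_prod_monoid.
move=> k g _; pose W i w := component g i w.
pose P (w : seq 'I_k) := exists v : seq (A * bool), forall i,
  pres_congr (@erase_rels A R i) (erase i v) (erase i (W i w)).
have PE w : range (@eps A R) (eval_word g w) <-> P w.
  rewrite range_epsP; split=> -[v vw]; exists v => i.
    by apply/inv_class_eq; rewrite -[LHS]/(erased_class i v) vw -eval_component.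
  by rewrite -eval_component; apply/inv_class_eq; exact: vw.
have -> : [set w | range (@eps A R) (eval_word g w)] = P.
  by apply/funext => w; apply/propext; exact: PE.
have eA : enumerable (A * bool)%type := enumerable_fin _.
apply: semidecidable_word_codes.
  apply: semidecidable_ex (enumerable_seq eA) _.
  apply: semidecidable_forall => i.
  have -> : @erase_rels A R i = [set` [seq (erase i r.1, erase i r.2) | r <- rs]].
    apply/seteqP; split=> [_ [r + <-]|_ /mapP[r rrs ->]].
      by rewrite RE => rrs; apply: map_f.
    by exists r; rewrite // RE.
  apply: (semidecidable_comp (f := fun z : seq 'I_k * seq (A * bool) =>
    (erase i z.2, erase i (W i z.1))) _ (semidecidable_pres_congr _)).
  computability; apply: (computable_comp (computable_erase i)); computability.
  by apply: (computable_comp (computable_component g i)); computability.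
(* States are named by words over [A]: the completeness construction names them by representatives,
   and words can be enumerated. *)
have sN : semidecidable (fun w => exists z, separates rs (W^~ w)
    (z : automaton A (seq (A * bool)) * seq (seq (option (A * seq (A * bool)))))).
  apply: semidecidable_ex; last first.
    apply: semidecidable_computable; apply: computable_separates.
    exact: computable_component.
  have eS := enumerable_pair (enumerable_fin A) (enumerable_seq eA).
  apply: enumerable_pair; last first.
    exact: enumerable_seq (enumerable_seq (enumerable_option eS)).
  apply: enumerable_pair (enumerable_seq eS) (enumerable_seq _).
  exact: enumerable_pair (enumerable_pair eS eA) eS.
apply: semidecidable_iff sN _ => w; split=> [[z]|nP].
  exact: separates_sound RE.
apply: (separates_complete wagner_erased_class erased_reprK) => //.
- exact: erased_class_letter.
- move=> i r rrs; apply/inv_class_eq; apply: congr_base; right.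
  by exists r; rewrite // RE.
- by move=> [v vw]; apply: nP; exists v => i; apply/inv_class_eq; exact: vw.
Qed.

End Decidability.

Theorem corollary4p6 :
  (forall (A : finType) (R : set (word A * word A)),
     finite_set R ->
     (forall i : A, finite_J_above (erased_monoid R i)) ->
     decidable_membership (range (@eps A R)))
  /\
  (forall A : finType,
     decidable_membership (range (@eps A (set0 : set (word A * word A))))).
Proof.
split=> [A R fR above|A]; first exact: decidable_range_eps.
apply: decidable_range_eps => // i.
(* Erasing a letter from the empty presentation leaves the free inverse monoid on the remaining
   letters. *)
have R0 : @erase_rels A set0 i = set0 by rewrite /erase_rels image_set0.
have : finite_J_above (inv_monoid (@erase_rels A set0 i)).
  by rewrite R0; exact: free_inverse_finite_J_above.
exact.
Qed.
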